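(* Let $\Gamma\in\mathcal U_\infty$, and suppose that $\Gamma$ has the decomposition $\Gamma=\bigoplus_{i=1}^M\alpha_i\Gamma_i$ into components, where $0\le M\le\infty$, every $\Gamma_i\in\mathcal U_\infty$ is connected, every $\alpha_i>0$ and $\sum_{i=1}^M\alpha_i\le1$. (i) Let $G_1$ be the connected component of $G(\infty,\Gamma)$ that contains vertex $1$, and let $|G_1|$ be its number of vertices. Then $|G_1|$ is almost surely either $1$ or $\infty$, with $\mathbb P(|G_1|=\infty)=\sum_{i=1}^M\alpha_i$ and $\mathbb P(|G_1|=1)=\alpha_0:=1-\sum_{i=1}^M\alpha_i$. (ii) Let $H$ be the infinite random graph with $V(H)=\mathbb N$ obtained from $G_1$ by relabelling the vertices in increasing order (as $1,2,\dots$) when $|G_1|=\infty$, and simply taking $H=E_\infty$, the infinite graph on $\mathbb N$ with no edges, when $|G_1|=1$. Then $H$ is an exchangeable infinite random graph, and $H$ has the same distribution as the mixture $\sum_{i=0}^M\alpha_i\mathcal L(G(\infty,\Gamma_i))$, where $\Gamma_0=\mathbf 0$. In other words, for any measurable set $A$ of infinite graphs on $\mathbb N$, $\mathbb P(H\in A)=\sum_{i=0}^M\alpha_i\mathbb P(G(\infty,\Gamma_i)\in A)$.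
   Context: Graphs are finite, simple, undirected, with at least one vertex, unless explicitly infinite; $v(G)=|V(G)|$, $e(G)=|E(G)|$. $\mathcal L(X)$ denotes the distribution of a random object $X$. A random graph on $\mathbb N$ is exchangeable if its distribution is invariant under permutations of $\mathbb N$. Graph limits. For graphs $F,G$, $t(F,G)$ is the probability that a uniformly random map $V(F)\to V(G)$ is a graph homomorphism (maps edges to edges). The set $\mathcal U$ of unlabelled graphs (isomorphism classes) is embedded as a dense subset of a compact metric space $\overline{\mathcal U}$; the elements of $\mathcal U_\infty=\overline{\mathcal U}\setminus\mathcal U$ are called graph limits, and $v(\Gamma)=\infty$ for $\Gamma\in\mathcal U_\infty$. Each $t(F,\cdot)$ extends continuously to $\overline{\mathcal U}$; a graph limit $\Gamma$ is determined by the numbers $t(F,\Gamma)$, $F$ ranging over all graphs; and a sequence $G_n$ in $\overline{\mathcal U}$ converges to $\Gamma\in\mathcal U_\infty$ iff $v(G_n)\to\infty$ and $t(F,G_n)\to t(F,\Gamma)$ for every graph $F$. (Concretely, graph limits can be identified with the families $(t_F)_F$ arising as $t_F=\lim_n t(F,G_n)$ for sequences of graphs with $v(G_n)\to\infty$ for which all these limits exist.) The trivial graph limit $\mathbf 0$ is the one with $t(F,\mathbf 0)=0$ if $e(F)\ge1$ and $1$ if $e(F)=0$. Direct sums and connectedness. For $0\le m\le\infty$, graph limits $(\Gamma_i)_{i=1}^m$ and weights $\alpha_i\ge0$ with $\sum_{i=1}^m\alpha_i\le1$, $\bigoplus_{i=1}^m\alpha_i\Gamma_i$ is the unique graph limit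 $\Gamma$ with $t(F,\Gamma)=\sum_{i=1}^m\alpha_i^{v(F)}t(F,\Gamma_i)$ for every connected graph $F$ with at least one edge (for $m=0$ it is $\mathbf 0$); for $m=2$ and weights $\alpha,1-\alpha$ it is written $\alpha\Gamma_1\oplus(1-\alpha)\Gamma_2$. A graph limit $\Gamma$ is disconnected if there exist $\Gamma_1,\Gamma_2\in\mathcal U_\infty$ and $\alpha\in(0,1)$ with $\Gamma=\alpha\Gamma_1\oplus(1-\alpha)\Gamma_2$; otherwise it is connected. Every graph limit has a decomposition into components of the form stated in the claim, unique up to simultaneous permutation of the $\Gamma_i$ and $\alpha_i$. Random graphs. A kernel on a probability space $(\mathcal S,\mu)$ is a symmetric measurable $W:\mathcal S\times\mathcal S\to[0,1]$; it represents the unique graph limit $\Gamma_W$ with $t(F,\Gamma_W)=\int_{\mathcal S^{v(F)}}\prod_{ij\in E(F)}W(x_i,x_j)\,d\mu(x_1)\cdots d\mu(x_{v(F)})$ for every graph $F$. Every graph limit is represented by some kernel. $G(\infty,\Gamma)$ is the infinite random graph with vertex set $\mathbb N=\{1,2,\dots\}$ obtained, for any kernel $W$ representing $\Gamma$, by taking i.i.d. $X_1,X_2,\dots$ with distribution $\mu$ and, conditionally given these, including each edge $ij$ ($i<j$) independently with probability $W(X_i,X_j)$. Its distribution depends only on $\Gamma$ and is characterized by $\mathbb P(G(\infty,\Gamma)\supseteq F)=t(F,\Gamma)$ for every graph $F$ with $V(F)=\{1,\dots,k\}$, $k\ge1$. *)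

(* Defs.v *)
From HB Require Import structures.
From mathcomp Require Import all_boot all_order all_algebra.
From mathcomp Require Import all_classical all_reals all_analysis.

Set Implicit Arguments.
Unset Strict Implicit.
Unset Printing Implicit Defensive.

Import Order.TTheory GRing.Theory Num.Theory.
Import numFieldNormedType.Exports.

Local Open Scope classical_set_scope.
Local Open Scope card_scope.
Local Open Scope ring_scope.

(* Finite simple graphs.  Every graph is taken on a vertex set
   {0, ..., n-1} with n >= 1, which costs nothing up to isomorphism. *)
Record sgraph := SGraph {
  nverts : nat;
  adj : rel 'I_nverts;
  nverts_gt0 : (0 < nverts)%N;
  adj_sym : symmetric adj;
  adj_irr : irreflexive adj }.

Definition size_edges (F : sgraph) : nat :=
  #|[pred p : 'I_(nverts F) * 'I_(nverts F) | (p.1 < p.2)%N && adj p.1 p.2]|.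

Definition sgraph_connected (F : sgraph) : bool :=
  [forall x, forall y, connect (@adj F) x y].

Definition is_hom (F G : sgraph) (f : {ffun 'I_(nverts F) -> 'I_(nverts G)}) :=
  [forall x, forall y, adj x y ==> adj (f x) (f y)].

Definition hom_density (R : realType) (F G : sgraph) : R :=
  #|[pred f | @is_hom F G f]|%:R
    / #|{: {ffun 'I_(nverts F) -> 'I_(nverts G)}}|%:R.

(* A graph limit is identified with the family of its densities. *)
Record graph_limit (R : realType) := GraphLimit {
  density :> sgraph -> R;
  densityP : exists Gs : nat -> sgraph,
    (nverts (Gs n) @[n --> \oo] --> \oo) /\
    forall F, hom_density R F (Gs n) @[n --> \oo] --> density F }.

Definition edgeless (n : nat) : sgraph :=
  @SGraph n.+1 (fun _ _ => false) isT (fun _ _ => erefl) (fun _ => erefl).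

Lemma hom_density_edgeless (R : realType) (F : sgraph) (n : nat) :
  hom_density R F (edgeless n) = (size_edges F == 0)%N%:R.
Proof.
rewrite /hom_density /size_edges.
set A := [pred f | _]; set E := [pred p | _].
have [E0|] := posnP #|E|.
  have noE x y : @adj F x y = false.
    wlog : x y / (x < y)%N => [H|xy].
      case: (ltngtP x y) => [|yx|/val_inj ->]; first exact: H.
        by rewrite adj_sym; exact: H.
      exact: adj_irr.
    by have := card0_eq E0 (x, y); rewrite inE /= xy.
  rewrite (eq_card (B := predT)) => [|f]; last first.
    rewrite !inE; apply/forallP => x; apply/forallP => y.
    by rewrite noE.
  rewrite divff // pnatr_eq0 -lt0n; apply/card_gt0P.
  by exists [ffun=> ord0].
move=> E0; move/card_gt0P: (E0) => [[x y]]; rewrite inE /= => /andP[_ xy].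
rewrite (_ : #|A| = 0%N) ?mul0r//.
apply: eq_card0 => f; rewrite !inE; apply/negbTE/negP.
by move=> /forallP/(_ x)/forallP/(_ y)/implyP/(_ xy).
Qed.

Lemma trivial_limit_subproof (R : realType) : exists Gs : nat -> sgraph,
  (nverts (Gs n) @[n --> \oo] --> \oo) /\
  forall F, hom_density R F (Gs n) @[n --> \oo] -->
            ((size_edges F == 0)%N%:R : R).
Proof.
exists edgeless; split=> [|F].
  by move=> A [N _ NA]; exists N => // n /= Nn; apply: NA => /=; exact: leqW.
under eq_fun do rewrite hom_density_edgeless.
exact: cvg_cst.
Qed.

Definition trivial_limit (R : realType) : graph_limit R :=
  GraphLimit (trivial_limit_subproof R).

(* The number M of summands is an element of {0, 1, ..., oo}; None is oo. *)
Definition le_size (i : nat) (M : option nat) : bool :=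
  if M is Some m then (i <= m)%N else true.

(* Gam is the direct sum of the alpha_i Gam_i, 1 <= i <= M; index 0 is not
   used. *)
Definition is_direct_sum (R : realType) (M : option nat)
    (alpha : nat -> R) (Gams : nat -> graph_limit R) (Gam : graph_limit R) :=
  forall F, sgraph_connected F -> (0 < size_edges F)%N ->
  (Gam F)%:E =
    (\sum_(1 <= i <oo | le_size i M) (alpha i ^+ nverts F * Gams i F)%:E)%E.

Definition disconnected_limit (R : realType) (Gam : graph_limit R) :=
  exists (Gam1 Gam2 : graph_limit R) (a : R), 0 < a < 1 /\
    is_direct_sum (Some 2) (fun i => if i == 1%N then a else 1 - a)
      (fun i => if i == 1%N then Gam1 else Gam2) Gam.

Definition connected_limit (R : realType) (Gam : graph_limit R) :=
  ~ disconnected_limit Gam.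

(* Infinite graphs, with vertex i : nat standing for i + 1 in {1, 2, ...}. *)
Record igraph := IGraph {
  iadj :> rel nat;
  iadj_sym : symmetric iadj;
  iadj_irr : irreflexive iadj }.

Definition igraph_empty : igraph :=
  @IGraph (fun _ _ => false) (fun _ _ => erefl) (fun _ => erefl).

HB.instance Definition _ := gen_eqMixin igraph.
HB.instance Definition _ := gen_choiceMixin igraph.
HB.instance Definition _ := isPointed.Build igraph igraph_empty.

Definition edge_event (p : nat * nat) : set igraph := [set g : igraph | g p.1 p.2].

Definition igraph_measurable : set (set igraph) := <<s range edge_event >>.

Lemma igraph_measurable0 : igraph_measurable set0.
Proof. exact: sigma_algebra0. Qed.

Lemma igraph_measurableC (A : set igraph) :
  igraph_measurable A -> igraph_measurable (~` A).
Proof. exact: sigma_algebraC. Qed.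

Lemma igraph_measurableU (F : (set igraph)^nat) :
  (forall i, igraph_measurable (F i)) -> igraph_measurable (\bigcup_i F i).
Proof. exact: sigma_algebra_bigcup. Qed.

Definition igraph_display : measure_display.
Proof. by constructor. Qed.

HB.instance Definition _ :=
  @isMeasurable.Build igraph_display igraph igraph_measurable
    igraph_measurable0 igraph_measurableC igraph_measurableU.

(* The graph on nat in which i, j are adjacent iff f i, f j are so in g. *)
Definition igraph_pull (f : nat -> nat) (g : igraph) : igraph :=
  @IGraph (fun i j => g (f i) (f j))
    (fun i j => iadj_sym g (f i) (f j)) (fun i => iadj_irr g (f i)).

Definition component (g : igraph) (v : nat) : set nat :=
  [set u | exists2 p : seq nat, path g v p & last v p = u].

(* For infinite C, nth_elt C 0 < nth_elt C 1 < ... enumerates C: the i-th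
   value is the element of C with exactly i elements of C below it. *)
Definition nth_elt (C : set nat) (i : nat) : nat :=
  xget 0%N [set c | C c /\ C `&` `I_c #= `I_i].

(* The graph H obtained from the component of the first vertex.  When that
   component is finite, the edgeless graph is used whatever its size. *)
Definition relabelled_component (g : igraph) : igraph :=
  if `[< infinite_set (component g 0%N) >]
  then igraph_pull (nth_elt (component g 0%N)) g
  else igraph_empty.

Record graph_kernel (R : realType) d (S : measurableType d) := GraphKernel {
  kernel_fun :> S -> S -> R;
  kernel_measurable : measurable_fun setT (fun z : S * S => kernel_fun z.1 z.2);
  kernel_sym : forall x y, kernel_fun x y = kernel_fun y x;
  kernel_ge0 : forall x y, 0 <= kernel_fun x y;
  kernel_le1 : forall x y, kernel_fun x y <= 1 }.

(* \int ... \int f (x_0, ..., x_(n-1)) dmu(x_0) ... dmu(x_(n-1)) *)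
Fixpoint iterated_integral (R : realType) d (S : measurableType d)
    (mu : probability S R) (n : nat) : (n.-tuple S -> \bar R) -> \bar R :=
  match n with
  | 0 => fun f => f [tuple]
  | m.+1 => fun f =>
      (\int[mu]_x iterated_integral mu (fun s => f [tuple of x :: s]))%E
  end.

Definition kernel_density (R : realType) d (S : measurableType d)
    (mu : probability S R) (W : graph_kernel R S) (F : sgraph) : \bar R :=
  iterated_integral mu (fun x : (nverts F).-tuple S =>
    (\prod_(i < nverts F) \prod_(j < nverts F | (i < j)%N && adj i j)
       W (tnth x i) (tnth x j))%:E).

Definition represents (R : realType) d (S : measurableType d)
    (mu : probability S R) (W : graph_kernel R S) (Gam : graph_limit R) :=
  forall F, kernel_density mu W F = (Gam F)%:E.

(* The X_i are independent with common distribution mu. *)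
Definition iid (R : realType) d (S : measurableType d) (mu : probability S R)
    d' (T : measurableType d') (P : probability T R)
    (X : nat -> {RV P >-> S}) :=
  forall (n : nat) (B : nat -> set S), (forall i, measurable (B i)) ->
  P (\bigcap_(i in `I_n) (X i @^-1` B i)) = (\prod_(i < n) mu (B i))%E.

Definition sigma_generated d (S : measurableType d) (T : Type)
    (X : nat -> T -> S) : set (set T) :=
  <<s \bigcup_i preimage_set_system setT (X i) measurable >>.

(* Conditionally given (X_i)_i, the edges i j, i < j, of G are present
   independently, with probabilities W (X_i, X_j): the conditional probability
   that G coincides with h on the first n vertices is the product below. *)
Definition sampled_edges (R : realType) d (S : measurableType d)
    (W : graph_kernel R S) d' (T : measurableType d') (P : probability T R)
    (X : nat -> {RV P >-> S}) (G : {RV P >-> igraph}) :=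
  forall (n : nat) (h : igraph) (C : set T), sigma_generated X C ->
  P (C `&` [set w | forall i j, (i < j < n)%N -> G w i j = h i j]) =
  (\int[P]_(w in C)
     (\prod_(i < n) \prod_(j < n | (i < j)%N)
        (if h i j then W (X i w) (X j w) else 1 - W (X i w) (X j w)))%:E)%E.

(* The random graph G has the distribution of G(oo, Gam). *)
Definition is_Ginfty (R : realType) (Gam : graph_limit R)
    d (T : measurableType d) (P : probability T R) (G : {RV P >-> igraph}) :=
  exists d1 (S : measurableType d1) (mu : probability S R)
         (W : graph_kernel R S) d2 (T' : measurableType d2)
         (P' : probability T' R) (X : nat -> {RV P' >-> S})
         (G' : {RV P' >-> igraph}),
    [/\ represents mu W Gam, iid mu X, sampled_edges W X G' &
        forall A, measurable A -> distribution P G A = distribution P' G' A].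

(* Includes that H is a random graph, i.e. measurable. *)
Definition exchangeable (R : realType) d (T : measurableType d)
    (P : probability T R) (H : T -> igraph) :=
  measurable_fun setT H /\
  forall s : nat -> nat, bijective s -> forall A, measurable A ->
  P ((igraph_pull s \o H) @^-1` A) = P (H @^-1` A).

(* Main.v *)
Require Import Defs.
From HB Require Import structures.
From mathcomp Require Import all_boot all_order all_algebra.
From mathcomp Require Import all_classical all_reals all_analysis.
From mathcomp Require Import measurable_realfun zify lra.

Set Implicit Arguments.
Unset Strict Implicit.
Unset Printing Implicit Defensive.

Import Order.TTheory GRing.Theory Num.Theory.
Import numFieldNormedType.Exports.

Local Open Scope classical_set_scope.
Local Open Scope card_scope.
Local Open Scope ring_scope.

(** Colour the vertices independently, giving colour i with probability
    alpha i, let the vertices of each colour i >= 1 span a sample from Gams i,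
    and draw no other edge: by the definition of a direct sum, a finite
    connected graph with an edge has the same probability of being contained in
    this random graph as in a sample from Gam. A sample from a connected limit is almost
    surely connected. Hence the component of the first vertex is its colour
    class: it is infinite if the colour is at least 1, and a singleton if the
    colour is 0, as Gams 0 gives an edgeless graph. After relabelling, the
    colour class is again a sample from Gams i, by exchangeability.

    Only the component of the first vertex matters, and this avoids the full
    colouring. If F is a finite connected graph with k >= 2 vertices, one of
    which is the first vertex, then the component contains F exactly when the whole
    graph does, which has probability Gam F, the sum of
    alpha i ^ k * Gams i F. The same number is obtained by choosing i with
    probability alpha i, thinning a sample from Gams i by keeping each vertex
    other than the first with probability alpha i, and asking that F be
    contained in the result ([law_on_rooted_events]). These events form a
    pi-system, and they generate every event that depends on the component of
    the first vertex only ([component_graph_rooted]). So the law of the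
    component is a mixture of laws of thinned samples, each of which can be
    studied with its marks fixed ([thinned_law_when_connected]). The marks are
    digits of a uniform point of [0, 1[ ([mark_pattern]).

    The main point is that a connected limit Gam has almost surely connected
    samples ([prob_connected_graph]). The initial graphs of a sample converge
    to Gam in probability ([sampled_density_far]), by a second moment
    computation in which the square of a density is the density of two
    disjoint copies. Let C be the component of the first vertex. If the
    proportion of C in the initial graphs stayed away from 0 and 1, then along
    a subsequence C and its complement, which are not joined by edges, would
    span graphs converging to two limits, and Gam would be their direct sum
    ([disconnected_of_cuts]). So among the pairs (i, j) of initial vertices,
    those with i in C and j outside C are rare, and since by exchangeability
    they all have the same probability, this probability is 0
    ([prob_splits0]). A graph in which no vertex is connected to one of two
    others and not to the other is connected or edgeless, and the second case
    is excluded because the trivial limit is disconnected.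

    Everything rests on the fact that a sample from Gam contains a given
    finite graph F, on any given vertices, with probability Gam F
    ([Ginfty_has_densities]); this determines its law ([same_law]) and makes
    it invariant under injective relabellings ([law_igraph_pull]). *)

(** * Densities of finite graphs and of graph limits *)

Lemma is_homP (F G : sgraph) (f : {ffun 'I_(nverts F) -> 'I_(nverts G)}) :
  reflect (forall x y, adj x y -> adj (f x) (f y)) (is_hom f).
Proof.
apply: (iffP forallP) => [H x y xy|H x].
  by have /forallP/(_ y)/implyP := H x; apply.
by apply/forallP => y; apply/implyP; exact: H.
Qed.

Lemma nverts_gt0R (R : realType) (G : sgraph) : 0 < (nverts G)%:R :> R.
Proof. by rewrite ltr0n nverts_gt0. Qed.

Lemma card_maps_gt0 (R : realType) (F G : sgraph) :
  0 < #|{: {ffun 'I_(nverts F) -> 'I_(nverts G)}}|%:R :> R.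
Proof.
by rewrite card_ffun !card_ord natrX exprn_gt0// nverts_gt0R.
Qed.

(** Every map on the small index set has the same number of extensions along
    an injection, so a uniformly random map restricts to a uniformly random
    map. *)
Lemma card_extensions (I J V : finType) (phi : I -> J) :
  injective phi -> exists c : nat, forall A : pred {ffun I -> V},
  #|[pred g : {ffun J -> V} | A [ffun i => g (phi i)]]| = (#|A| * c)%N.
Proof.
move=> phi_inj.
pose Fam (a : {ffun I -> V}) j : pred V :=
  [pred v | [forall i, (phi i == j) ==> (v == a i)]].
pose c := foldr muln 1%N [seq (if j \in codom phi then 1 else #|V|)%N | j : J].
have famE (a : {ffun I -> V}) (g : {ffun J -> V}) :
    ([ffun i => g (phi i)] == a) = (g \in family (Fam a)).
  apply/eqP/familyP => [<- j|H].
    by rewrite inE; apply/forallP => i; apply/implyP => /eqP <-; rewrite ffunE.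
  apply/ffunP => i; rewrite ffunE.
  have := H (phi i); rewrite inE => /forallP/(_ i).
  by rewrite eqxx => /eqP.
have cardFam a : #|family (Fam a)| = c.
  rewrite card_family /c; congr foldr; apply: eq_map => j.
  case: ifPn => [/codomP[i ->]|jn].
    rewrite -(card1 (a i)); apply: eq_card => v; rewrite !inE.
    apply/forallP/eqP => [/(_ i)|-> i']; first by rewrite eqxx => /eqP.
    by apply/implyP => /eqP/phi_inj ->.
  apply: eq_card => v; rewrite !inE; apply/forallP => i; apply/implyP => /eqP ij.
  by case/negP: jn; rewrite -ij codom_f.
exists c => A.
rewrite -sum1_card (partition_big (fun g : {ffun J -> V} =>
  [ffun i => g (phi i)] : {ffun I -> V}) A)//=.
rewrite -sum1_card big_distrl/=; apply: eq_bigr => a Aa.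
rewrite mul1n -(cardFam a) -sum1_card; apply: eq_bigl => g.
by rewrite -famE inE /=; case: eqP => [->|]; rewrite ?andbT ?andbF.
Qed.

(** This covers both relabelling the vertices and adding isolated ones. *)
Lemma hom_density_embed (R : realType) (F F' G : sgraph)
    (phi : 'I_(nverts F) -> 'I_(nverts F')) : injective phi ->
  (forall a b, adj a b <-> exists i j, [/\ adj i j, phi i = a & phi j = b]) ->
  hom_density R F G = hom_density R F' G.
Proof.
move=> phi_inj adjE.
have [c cE] := card_extensions 'I_(nverts G) phi_inj.
have F'E : #|[pred g | @is_hom F' G g]| = (#|[pred f | @is_hom F G f]| * c)%N.
  rewrite -cE; apply: eq_card => g; rewrite !inE.
  apply/is_homP/is_homP => [H x y xy|H a b].
    by rewrite !ffunE; apply: H; apply/adjE; exists x, y.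
  by move/adjE => [i [j [ij <- <-]]]; have := H _ _ ij; rewrite !ffunE.
have TE : #|{: {ffun 'I_(nverts F') -> 'I_(nverts G)}}| =
    (#|{: {ffun 'I_(nverts F) -> 'I_(nverts G)}}| * c)%N.
  by rewrite -(cE predT); apply: eq_card => g; rewrite !inE.
have c0 : (c%:R : R) != 0.
  have := card_maps_gt0 R F' G; rewrite TE natrM.
  by case: (eqVneq (c%:R : R) 0) => // ->; rewrite mulr0 ltxx.
rewrite /hom_density F'E TE !natrM.
by rewrite -mulf_div divff// mulr1.
Qed.

Lemma limit_density_embed (R : realType) (Gam : graph_limit R) (F F' : sgraph)
    (phi : 'I_(nverts F) -> 'I_(nverts F')) : injective phi ->
  (forall a b, adj a b <-> exists i j, [/\ adj i j, phi i = a & phi j = b]) ->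
  Gam F = Gam F'.
Proof.
move=> phi_inj adjE; have [Gs [_ cvgG]] := densityP Gam.
have E : (fun n => hom_density R F (Gs n)) = (fun n => hom_density R F' (Gs n)).
  by apply/funext => n; exact: hom_density_embed phi_inj adjE.
by apply: (cvg_unique _ (cvgG F)) => //; rewrite E; exact: cvgG.
Qed.

(** Two independent copies of a random map, seen as one map from a disjoint
    union: this turns a product of densities, in particular a second moment,
    into the density of a single graph. *)
Section disjoint_union.
Variables F F' : sgraph.

Definition dunion_adj : rel 'I_(nverts F + nverts F') := fun x y =>
  match fintype.split x, fintype.split y with
  | inl a, inl b => adj a b
  | inr a, inr b => adj a b
  | _, _ => false
  end.

Lemma dunion_gt0 : (0 < nverts F + nverts F')%N.
Proof. by rewrite addn_gt0 nverts_gt0. Qed.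

Lemma dunion_sym : symmetric dunion_adj.
Proof.
move=> x y; rewrite /dunion_adj.
by case: (fintype.split x) => a; case: (fintype.split y) => b //; exact: adj_sym.
Qed.

Lemma dunion_irr : irreflexive dunion_adj.
Proof.
by move=> x; rewrite /dunion_adj; case: (fintype.split x) => a; exact: adj_irr.
Qed.

Definition dunion : sgraph := SGraph dunion_gt0 dunion_sym dunion_irr.

Lemma hom_density_dunion (R : realType) (G : sgraph) :
  hom_density R dunion G = hom_density R F G * hom_density R F' G.
Proof.
rewrite /hom_density mulf_div -!natrM.
pose V := 'I_(nverts G).
pose h (p : {ffun 'I_(nverts F) -> V} * {ffun 'I_(nverts F') -> V}) :
    {ffun 'I_(nverts dunion) -> V} :=
  [ffun x => match fintype.split x with inl a => p.1 a | inr b => p.2 b end].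
have h_inj : injective h.
  move=> [p q] [p' q'] E.
  have hE x : h (p, q) x = h (p', q') x by rewrite E.
  congr pair; apply/ffunP => a.
    have := hE (lshift (nverts F') a); rewrite !ffunE.
    by rewrite (unsplitK (inl a : 'I_(nverts F) + 'I_(nverts F'))).
  have := hE (rshift (nverts F) a); rewrite !ffunE.
  by rewrite (unsplitK (inr a : 'I_(nverts F) + 'I_(nverts F'))).
have hS (f : {ffun 'I_(nverts dunion) -> V}) : f = h ([ffun a => f (lshift (nverts F') a)],
                   [ffun b => f (rshift (nverts F) b)]).
  apply/ffunP => x; rewrite ffunE /=; case: (fintype.splitP x) => a ax.
    by rewrite ffunE; congr (f _); apply: val_inj.
  by rewrite ffunE; congr (f _); apply: val_inj.
congr (_%:R / _%:R); last by rewrite !card_ffun !card_ord expnD.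
rewrite -cardX -(fintype.card_image h_inj); apply: eq_card => f.
apply/idP/fintype.imageP => [|[[p q]]].
  rewrite inE => /is_homP H; eexists; last exact: hS.
  rewrite !inE/=; apply/andP; split; apply/is_homP => x y xy; rewrite !ffunE.
    apply: H; rewrite /= /dunion_adj.
    rewrite (unsplitK (inl x : 'I_(nverts F) + 'I_(nverts F'))).
    by rewrite (unsplitK (inl y : 'I_(nverts F) + 'I_(nverts F'))).
  apply: H; rewrite /= /dunion_adj.
  rewrite (unsplitK (inr x : 'I_(nverts F) + 'I_(nverts F'))).
  by rewrite (unsplitK (inr y : 'I_(nverts F) + 'I_(nverts F'))).
rewrite inE /= => /andP[/is_homP /= Hp /is_homP /= Hq] ->; rewrite inE.
apply/is_homP => x y; rewrite /= /dunion_adj !ffunE.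
by case: (fintype.split x) => a; case: (fintype.split y) => b //;
  [exact: Hp|exact: Hq].
Qed.

Lemma limit_density_dunion (R : realType) (Gam : graph_limit R) :
  Gam dunion = Gam F * Gam F'.
Proof.
have [Gs [_ cvgG]] := densityP Gam.
have E : (fun n => hom_density R dunion (Gs n)) =
    (fun n => hom_density R F (Gs n)) \* (fun n => hom_density R F' (Gs n)).
  by apply/funext => n; exact: hom_density_dunion.
apply: (cvg_unique _ (cvgG dunion)) => //.
by rewrite E; exact: cvgM (cvgG _) (cvgG _).
Qed.

End disjoint_union.

Lemma hom_density_ge0 (R : realType) (F G : sgraph) : 0 <= hom_density R F G.
Proof. by rewrite divr_ge0. Qed.

Lemma hom_density_le1 (R : realType) (F G : sgraph) : hom_density R F G <= 1.
Proof.
by rewrite ler_pdivrMr ?card_maps_gt0// mul1r ler_nat max_card.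
Qed.

Lemma limit_density_ge0 (R : realType) (Gam : graph_limit R) F : 0 <= Gam F.
Proof.
have [Gs [_ cvgG]] := densityP Gam; rewrite -(cvg_lim _ (cvgG F))//.
by apply: limr_ge; [apply/cvg_ex; eexists; exact: cvgG|
  near=> n; exact: hom_density_ge0].
Unshelve. all: by end_near. Qed.

Lemma limit_density_le1 (R : realType) (Gam : graph_limit R) F : Gam F <= 1.
Proof.
have [Gs [_ cvgG]] := densityP Gam; rewrite -(cvg_lim _ (cvgG F))//.
by apply: limr_le; [apply/cvg_ex; eexists; exact: cvgG|
  near=> n; exact: hom_density_le1].
Unshelve. all: by end_near. Qed.


(** * Densities of the random graph represented by a kernel *)

(** Uniqueness is needed on sub-sigma-algebras too: the component of the first
    vertex does not determine the whole graph. *)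
Lemma probability_unique_on d (T : measurableType d) (R : realType)
    (m1 m2 : {measure set T -> \bar R}) (C : set (set T)) :
  C `<=` measurable -> setI_closed C -> C setT -> (m1 setT < +oo)%E ->
  (forall A, C A -> m1 A = m2 A) -> forall A, <<s C >> A -> m1 A = m2 A.
Proof.
move=> mC CI CT m1T m12 A CA.
apply: (g_sigma_algebra_measure_unique C mC (fun=> setT)) => //.
by rewrite bigcup_const//; exists 0%N.
Qed.

(** Packs a measurability proof with the function, so that image measures can
    be formed. *)
Definition to_mfun d d' (T : measurableType d) (T' : measurableType d')
    (f : T -> T') (mf : measurable_fun setT f) : {mfun T >-> T'} :=
  HB.pack f (isMeasurableFun.Build _ _ _ _ f mf).

Definition image_measure d d' (T : measurableType d) (T' : measurableType d')
    (R : realType) (m : {measure set T -> \bar R}) (f : {mfun T >-> T'}) :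
    {measure set T' -> \bar R} :=
  measure_function_pushforward__canonical__measure_function_Measure
    m (@measurable_funPT _ _ _ _ f).

Section iid_integral.
Context (R : realType) d (S : measurableType d) (mu : probability S R)
  d' (T : measurableType d') (P : probability T R).
Local Open Scope ereal_scope.

Definition tuple_rectangles n : set (set (n.-tuple S)) :=
  [set A | exists B : nat -> set S, (forall i, measurable (B i)) /\
     A = [set x | forall i : 'I_n, B i (tnth x i)]].

Lemma measurable_tuple_rectangle n : @tuple_rectangles n `<=` measurable.
Proof.
move=> _ [B [mB ->]].
rewrite (_ : [set x | _] = \bigcap_(i : 'I_n) (@tnth n S ^~ i @^-1` B i)).
  apply: fin_bigcap_measurable => // i _; rewrite -[X in measurable X]setTI.
  exact: measurable_tnth.
by rewrite eqEsubset; split=> x /= H i; [move=> _|]; exact: H.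
Qed.

Lemma measurable_tuple_generated n (A : set (n.-tuple S)) :
  measurable A -> <<s @tuple_rectangles n >> A.
Proof.
apply: smallest_sub; first exact: smallest_sigma_algebra.
rewrite -bigcup_seq => _ [i /= _ [B mB <-]].
apply: sub_sigma_algebra.
exists (fun j => if j == i :> nat then B else setT); split.
  by move=> j; case: ifP.
rewrite setTI eqEsubset; split=> x /= H.
  by move=> j; case: eqP => // /val_inj ->.
by have := H i; rewrite eqxx.
Qed.

Definition sample_tuple (X : nat -> T -> S) n (w : T) : n.-tuple S :=
  [tuple X i w | i < n].

Lemma measurable_sample_tuple (X : nat -> {RV P >-> S}) n :
  measurable_fun setT (sample_tuple X n).
Proof.
apply/measurable_fun_tnthP => i.
rewrite (_ : _ \o _ = X i); first exact: measurable_funPT.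
by apply/funext => w /=; rewrite tnth_mktuple.
Qed.

Lemma iid_shift (X : nat -> {RV P >-> S}) :
  iid mu X -> iid mu (fun i => X i.+1).
Proof.
move=> iidX n B mB.
have := iidX n.+1 (fun i => if i is j.+1 then B j else setT).
rewrite big_ord_recl /= probability_setT mul1e => <-; last by case.
congr (P _); rewrite eqEsubset; split=> w /= H i /= ilt.
  by case: i ilt => // i ilt; exact: H.
exact: (H i.+1).
Qed.

(** Independence is assumed on rectangles; both sides are measures in C, so it
    extends to all measurable sets of tuples. *)
Lemma iid_head_tail (X : nat -> {RV P >-> S}) n : iid mu X ->
  forall A C, measurable A -> measurable C ->
  P (X 0%N @^-1` A `&` sample_tuple (fun i => X i.+1) n @^-1` C) =
  mu A * P (sample_tuple (fun i => X i.+1) n @^-1` C).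
Proof.
move=> iidX A C mA mC.
pose Y := to_mfun (@measurable_sample_tuple (fun i => X i.+1) n).
have mXA : measurable (X 0%N @^-1` A).
  by rewrite -[X in measurable X]setTI; exact: measurable_funPT.
pose m1 := image_measure (mrestr P mXA) Y.
have muA0 : (0 <= fine (mu A))%R by rewrite fine_ge0.
pose m2 := mscale (NngNum muA0) (distribution P Y).
suff : m1 C = m2 C.
  rewrite /m1 /m2 /= /pushforward /mrestr /mscale /distribution /pushforward /=.
  rewrite fineK ?fin_num_measure//.
  by rewrite setIC.
have := measurable_tuple_generated mC.
apply: (@probability_unique_on _ _ _ m1 m2).
- exact: measurable_tuple_rectangle.
- move=> _ _ [B [mB ->]] [B' [mB' ->]].
  exists (fun i => B i `&` B' i); split; first by move=> i; exact: measurableI.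
  rewrite eqEsubset; split=> x /=.
    by move=> [H H'] i; split; [exact: H|exact: H'].
  by move=> H; split=> i; have [] := H i.
- by exists (fun=> setT); split => //; rewrite eqEsubset; split.
- rewrite /m1 /= /pushforward /mrestr /=.
  rewrite preimage_setT setTI.
  by apply: le_lt_trans (probability_le1 _ _) _; rewrite ?ltry.
- move=> _ [B [mB ->]].
  rewrite /m1 /m2 /= /pushforward /mrestr /mscale /distribution /pushforward /=.
  rewrite fineK ?fin_num_measure//.
  have YE : Y @^-1` [set x | forall i : 'I_n, B i (tnth x i)] =
      \bigcap_(i in `I_n) (X i.+1 @^-1` B i).
    rewrite eqEsubset; split=> w /= H.
      by move=> i ilt; have := H (Ordinal ilt); rewrite tnth_mktuple.
    by move=> i; rewrite tnth_mktuple; exact: (H i (ltn_ord i)).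
  have -> : distribution P Y [set x | forall i : 'I_n, B i (tnth x i)] =
      P (\bigcap_(i in `I_n) (X i.+1 @^-1` B i)) by rewrite -YE.
  rewrite YE (iid_shift iidX)//.
  have := iidX n.+1 (fun i => if i is j.+1 then B j else A).
  rewrite big_ord_recl /= => <-; last by case.
  congr (P _); rewrite eqEsubset; split=> w /=.
    by move=> [H H0] [|i] /= ilt //; exact: H.
  by move=> H; split; [move=> i ilt; exact: (H i.+1)|exact: (H 0%N)].
Qed.

Lemma sample_tupleS (X : nat -> {RV P >-> S}) n w :
  sample_tuple X n.+1 w =
  [tuple of X 0%N w :: sample_tuple (fun i => X i.+1) n w].
Proof.
apply: eq_from_tnth => i; rewrite tnth_mktuple.
case: (unliftP ord0 i) => [j|] ->; last by rewrite tnth0.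
by rewrite tnthS tnth_mktuple.
Qed.

(** Integrating out the first variable by Tonelli's theorem leaves the tuple
    of the other ones, which is again independent and identically
    distributed. *)
Lemma iid_integralE n (X : nat -> {RV P >-> S}) : iid mu X ->
  forall f : n.-tuple S -> \bar R, measurable_fun [set: n.-tuple S] f ->
  (forall x, 0 <= f x) ->
  \int[P]_w f (sample_tuple X n w) = iterated_integral mu f.
Proof.
elim: n X => [|n IH] X iidX f mf f0.
  rewrite /= (eq_integral (fun=> f [tuple])); last first.
    by move=> w _; congr f; apply: eq_from_tnth; case.
  by rewrite integral_cst//= probability_setT mule1.
pose Y := to_mfun (@measurable_sample_tuple (fun i => X i.+1) n).
pose m : {mfun T >-> (S * n.-tuple S)%type} :=
  to_mfun (measurable_fun_pair (measurable_funPT (X 0%N)) (measurable_funPT Y)).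
pose g (z : S * n.-tuple S) := f [tuple of z.1 :: z.2].
have mg : measurable_fun setT g.
  by apply: (measurableT_comp mf); exact: measurable_cons.
transitivity (\int[distribution P m]_z g z).
  rewrite ge0_integral_distribution//; last by move=> z; exact: f0.
  by apply: eq_integral => w _; rewrite sample_tupleS.
transitivity (\int[mu \x distribution P Y]_z g z).
  apply: eq_measure_integral => A mA _; apply/esym.
  apply: product_measure_unique => // B C mB mC.
  exact: iid_head_tail.
rewrite fubini_tonelli1//; last by move=> z; exact: f0.
rewrite /=; apply: eq_integral => x _; rewrite /fubini_F.
rewrite ge0_integral_distribution//; last by move=> z; exact: f0.
  by rewrite -(IH (fun i => X i.+1))//; [exact: iid_shift|
    exact: (measurable_fun_pair2 x mg)].
exact: (measurable_fun_pair2 x mg).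
Qed.

End iid_integral.

Section measurable_predicates.
Context d (T : measurableType d).

Lemma measurable_exists (I : countType) (A : I -> set T) :
  (forall i, measurable (A i)) -> measurable [set x | exists i, A i x].
Proof.
move=> mA.
rewrite (_ : [set x | _] =
    \bigcup_n (if unpickle n is Some i then A i else set0)); last first.
  rewrite eqEsubset; split=> x /=.
    by move=> [i Aix]; exists (pickle i) => //; rewrite pickleK.
  by move=> [n _]; case: unpickle => // i Aix; exists i.
by apply: bigcupT_measurable => n; case: unpickle.
Qed.

Lemma measurable_forall (I : countType) (A : I -> set T) :
  (forall i, measurable (A i)) -> measurable [set x | forall i, A i x].
Proof.
move=> mA; rewrite (_ : [set x | _] = ~` [set x | exists i, (~` A i) x]).
  by apply: measurableC; apply: measurable_exists => i; exact: measurableC.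
rewrite eqEsubset; split=> x /=; first by move=> H [i]; apply; exact: H.
by move=> H i; apply: contrapT => nA; apply: H; exists i.
Qed.

Lemma measurable_guard (Q : Prop) (A : set T) :
  measurable A -> measurable [set x | Q -> A x].
Proof.
move=> mA; have [q|nq] := pselect Q.
  by rewrite (_ : [set x | _] = A)// eqEsubset; split=> x //= H; apply: H.
by rewrite (_ : [set x | _] = setT)// eqEsubset; split=> x //= _ /nq.
Qed.

Lemma measurable_constI (Q : Prop) (A : set T) :
  measurable A -> measurable [set x | Q /\ A x].
Proof.
move=> mA; have [q|nq] := pselect Q.
  by rewrite (_ : [set x | _] = A)// eqEsubset; split=> x //= -[].
by rewrite (_ : [set x | _] = set0)// eqEsubset; split=> x //= -[].
Qed.

End measurable_predicates.

Lemma measurable_edge (i j : nat) (b : bool) :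
  measurable [set g : igraph | g i j = b].
Proof.
have mE : measurable (edge_event (i, j)) by apply: sub_sigma_algebra; exists (i, j).
case: b => //; rewrite (_ : [set _ | _] = ~` edge_event (i, j)).
  exact: measurableC.
by rewrite eqEsubset; split=> g /=; rewrite /edge_event /=; case: (iadj g i j).
Qed.

Section edges_pattern.
Context (R : realType) d (S : measurableType d) (W : graph_kernel R S)
  d' (T : measurableType d') (P : probability T R)
  (X : nat -> {RV P >-> S}) (G : {RV P >-> igraph}).
Local Open Scope ereal_scope.

Definition edge_prob (b : bool) (x : R) : R := if b then x else (1 - x)%R.

Lemma edge_prob_ge0 b x y : (0 <= edge_prob b (W x y))%R.
Proof. by case: b => /=; rewrite ?subr_ge0 ?kernel_ge0 ?kernel_le1. Qed.

Lemma measurable_RV_preimage (A : set igraph) :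
  measurable A -> measurable (G @^-1` A).
Proof. by move=> mA; rewrite -[X in measurable X]setTI; exact: measurable_funPT. Qed.

Lemma measurable_edge_prob b i j :
  measurable_fun setT (fun w => edge_prob b (W (X i w) (X j w))).
Proof.
have mW : measurable_fun setT (fun w => W (X i w) (X j w)).
  apply: (measurableT_comp (kernel_measurable W)
    (g := fun w => (X i w, X j w))).
  by apply: measurable_fun_pair; exact: measurable_funPT.
by case: b => //=; exact: measurable_funB.
Qed.

Lemma measurable_pattern n (D : {set 'I_n * 'I_n}) (c : nat -> nat -> bool) :
  measurable [set g : igraph | forall p, p \in D -> g p.1 p.2 = c p.1 p.2].
Proof.
apply: measurable_forall => p.
exact: measurable_guard (measurable_edge _ _ _).
Qed.

(** The sampling rule prescribes the probabilities of complete patterns on an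
    initial segment; forgetting one pair at a time, the two possible values of
    the forgotten edge contribute factors W and 1 - W, which add up to 1. *)
Lemma sampled_pattern n (D : {set 'I_n * 'I_n}) (c : nat -> nat -> bool) :
  sampled_edges W X G -> (forall p, p \in D -> (p.1 < p.2)%N) ->
  P [set w | forall p, p \in D -> G w p.1 p.2 = c p.1 p.2] =
  \int[P]_w (\prod_(p in D) edge_prob (c p.1 p.2) (W (X p.1 w) (X p.2 w)))%:E.
Proof.
move=> sG; pose U := [set p : 'I_n * 'I_n | (p.1 < p.2)%N]%SET.
have [m Dm] := ubnP #|U :\: D|; elim: m => // m IH in D c Dm *.
move=> Dlt.
(* The induction is on the number of forgotten pairs. *)
have [/eqP|/set0Pn[q]] := eqVneq (U :\: D) finset.set0.
  rewrite finset.setD_eq0 => UD.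
  have {IH Dm Dlt UD} -> : D = U.
    apply/eqP; rewrite finset.eqEsubset UD andbT; apply/fintype.subsetP => p /Dlt.
    by rewrite finset.inE.
  pose hadj : rel nat := fun i j =>
    if (i < j)%N then c i j else if (j < i)%N then c j i else false.
  have hsym : symmetric hadj by move=> i j; rewrite /hadj; case: ltngtP.
  have hirr : irreflexive hadj by move=> i; rewrite /hadj ltnn.
  have genT : @sigma_generated _ S T X (~` set0).
    by apply: sigma_algebraC; exact: sigma_algebra0.
  rewrite setC0 in genT.
  have := sG n (IGraph hsym hirr) setT genT.
  rewrite setTI.
  have -> : [set w | forall i j, (i < j < n)%N -> G w i j = hadj i j] =
      [set w | forall p, p \in U -> G w p.1 p.2 = c p.1 p.2].
    rewrite eqEsubset; split=> w /= H.
      move=> [i j]; rewrite finset.inE /= => ij.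
      by rewrite H ?ij ?ltn_ord// /hadj ij.
    move=> i j /andP[ij jn]; rewrite /hadj ij.
    have := H (Ordinal (ltn_trans ij jn), Ordinal jn).
    by rewrite finset.inE /=; apply.
  move=> ->.
  apply: eq_integral => w _; congr (_%:E).
  rewrite pair_big_dep /=; apply: eq_big => [p|p ij].
    by rewrite finset.inE.
  by rewrite /hadj ij.
rewrite finset.inE => /andP[qD qU].
have qlt : (q.1 < q.2)%N by move: qU; rewrite finset.inE.
pose cq b i j := if (i == q.1 :> nat) && (j == q.2 :> nat) then b else c i j.
have cqq b : cq b q.1 q.2 = b by rewrite /cq !eqxx.
have cqD b p : p \in D -> cq b p.1 p.2 = c p.1 p.2.
  rewrite /cq; case: ifP => // /andP[/eqP/val_inj e1 /eqP/val_inj e2] pD.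
  by case/negP: qD; rewrite (surjective_pairing q) -e1 -e2 -surjective_pairing.
have Dq p : p \in (q |: D)%SET -> (p.1 < p.2)%N.
  by rewrite in_setU1 => /orP[/eqP ->|/Dlt].
have cardD : (#|U :\: (q |: D)%SET| < m)%N.
  rewrite -ltnS (leq_trans _ Dm)// ltnS proper_card//.
  apply/fintype.properP; split; first by rewrite finset.setDS// finset.subsetUr.
  by exists q; rewrite !finset.inE ?eqxx// qD; move: qU; rewrite finset.inE.
have IHb b := IH _ (cq b) cardD Dq.
pose E b := [set w | forall p, p \in (q |: D)%SET -> G w p.1 p.2 = cq b p.1 p.2].
have mE b : measurable (E b).
  exact: (measurable_RV_preimage (measurable_pattern (q |: D)%SET (cq b))).
rewrite (_ : [set w | _] = E true `|` E false); last first.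
  rewrite eqEsubset; split=> w /=.
    move=> H; case Gq : (G w q.1 q.2); [left|right] => p;
      rewrite in_setU1 => /orP[/eqP ->|pD]; rewrite ?cqq// cqD//; exact: H.
  by move=> [|] H p pD; rewrite H ?cqD// in_setU1 pD orbT.
have -> : P (E true `|` E false) = P (E true) + P (E false).
  apply: measureU => //.
  rewrite -subset0 => w [/(_ q) H1 /(_ q) H2].
  by move: H1 H2; rewrite setU11 !cqq => -> // /(_ isT).
have PE b : P (E b) = _ := IHb b.
rewrite !PE.
have mprod (D' : {set 'I_n * 'I_n}) (c' : nat -> nat -> bool) : measurable_fun setT (fun w =>
    (\prod_(p in D') edge_prob (c' p.1 p.2) (W (X p.1 w) (X p.2 w)))%:E).
  apply/measurable_EFinP; rewrite (_ : (fun w => _) = (fun w =>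
      \prod_(p <- enum D') edge_prob (c' p.1 p.2) (W (X p.1 w) (X p.2 w)))%R).
    by apply: measurable_prod => p _; exact: measurable_edge_prob.
  by apply/funext => w; rewrite big_enum.
have prod0 (D' : {set 'I_n * 'I_n}) (c' : nat -> nat -> bool) w : (0 <=
    \prod_(p in D') edge_prob (c' p.1 p.2) (W (X p.1 w) (X p.2 w)))%R.
  by apply: prodr_ge0 => p _; exact: edge_prob_ge0.
etransitivity.
  apply/esym/ge0_integralD => //.
  - by move=> w _; rewrite lee_fin; exact: prod0.
  - by move=> w _; rewrite lee_fin; exact: prod0.
apply: eq_integral => w _; rewrite -EFinD; congr (_%:E).
have splitq b : (\prod_(p in (q |: D)%SET)
      edge_prob (cq b p.1 p.2) (W (X p.1 w) (X p.2 w)) =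
    edge_prob b (W (X q.1 w) (X q.2 w)) *
    \prod_(p in D) edge_prob (c p.1 p.2) (W (X p.1 w) (X p.2 w)))%R.
  rewrite big_setU1//= cqq; congr (_ * _)%R.
  by apply: eq_bigr => p pD; rewrite cqD.
by rewrite !splitq -mulrDl /= addrC subrK mul1r.
Qed.

End edges_pattern.

(** * Random infinite graphs with given densities *)

Definition contains (F : sgraph) (f : 'I_(nverts F) -> nat) : set igraph :=
  [set g : igraph | forall x y, adj x y -> g (f x) (f y)].
Arguments contains : clear implicits.

Lemma measurable_contains F f : measurable (contains F f).
Proof.
apply: measurable_forall => x; apply: measurable_forall => y.
exact: measurable_guard (measurable_edge _ _ _).
Qed.

(** This property determines the distribution of a random graph, and it is
    easier to transport along relabellings than the construction from a
    kernel. *)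
Definition has_densities (R : realType) (Gam : graph_limit R)
    d (T : measurableType d) (P : probability T R) (G : {RV P >-> igraph}) :=
  forall F (f : 'I_(nverts F) -> nat), injective f ->
  P (G @^-1` contains F f) = (Gam F)%:E.

Section push_graph.
Variables (F : sgraph) (m : nat) (f : 'I_(nverts F) -> 'I_m).
Hypothesis f_inj : injective f.

(** The vertices outside the range of f are isolated, so that the density is
    that of F. *)
Definition push_adj : rel 'I_m := fun a b =>
  [exists x, exists y, [&& adj x y, f x == a & f y == b]].

Lemma push_adjP a b :
  reflect (exists x y, [/\ adj x y, f x = a & f y = b]) (push_adj a b).
Proof.
apply: (iffP existsP) => [[x /existsP[y /and3P[xy /eqP fx /eqP fy]]]|].
  by exists x, y.
move=> [x [y [xy <- <-]]]; exists x; apply/existsP; exists y.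
by rewrite xy !eqxx.
Qed.

Lemma push_gt0 : (0 < m)%N.
Proof. exact: leq_ltn_trans (leq0n _) (ltn_ord (f (Ordinal (nverts_gt0 F)))). Qed.

Lemma push_sym : symmetric push_adj.
Proof.
move=> a b; apply/push_adjP/push_adjP => -[x [y [xy <- <-]]].
  by exists y, x; split => //; rewrite adj_sym.
by exists y, x; split => //; rewrite adj_sym.
Qed.

Lemma push_irr : irreflexive push_adj.
Proof.
move=> a; apply/negbTE/negP => /push_adjP[x [y [xy <- /f_inj yx]]].
by move: xy; rewrite yx adj_irr.
Qed.

Definition push_graph : sgraph := SGraph push_gt0 push_sym push_irr.

Lemma limit_density_push (R : realType) (Gam : graph_limit R) :
  Gam F = Gam push_graph.
Proof.
apply: (@limit_density_embed _ Gam F push_graph f f_inj) => a b.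
by split => [/push_adjP//|?]; apply/push_adjP.
Qed.

End push_graph.

Section Ginfty_density.
Context (R : realType) (Gam : graph_limit R).
Local Open Scope ereal_scope.

Lemma kernel_densityE d (S : measurableType d) (mu : probability S R)
    (W : graph_kernel R S) d' (T : measurableType d') (P : probability T R)
    (X : nat -> {RV P >-> S}) (G : {RV P >-> igraph}) F :
  iid mu X -> sampled_edges W X G ->
  P (G @^-1` contains F (@nat_of_ord _)) = kernel_density mu W F.
Proof.
move=> iidX sG; set n := nverts F.
pose D := [set p : 'I_n * 'I_n | (p.1 < p.2)%N && adj p.1 p.2]%SET.
have -> : G @^-1` contains F (@nat_of_ord _) =
    [set w | forall p, p \in D -> G w p.1 p.2 = true].
  rewrite eqEsubset; split=> w /= H.
    by move=> [x y]; rewrite finset.inE => /andP[_ /H].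
  move=> x y xy; case: (ltngtP x y) => [lxy|lyx|/val_inj exy].
  - by have := H (x, y); rewrite finset.inE /= lxy xy; apply.
  - rewrite iadj_sym; have := H (y, x).
    by rewrite finset.inE /= lyx adj_sym xy; apply.
  - by move: xy; rewrite exy adj_irr.
rewrite (sampled_pattern (fun _ _ => true) sG); last first.
  by move=> p; rewrite finset.inE => /andP[].
rewrite /kernel_density -(iid_integralE iidX).
- apply: eq_integral => w _; congr (_%:E).
  rewrite pair_big_dep /=; apply: eq_big => [p|p _]; first by rewrite finset.inE.
  by rewrite !tnth_mktuple.
- apply/measurable_EFinP.
  rewrite (_ : (fun x => _) = (fun x : n.-tuple S =>
      \prod_(p <- enum D) W (tnth x p.1) (tnth x p.2))%R).
    apply: measurable_prod => p _.
    apply: (measurableT_comp (kernel_measurable W)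
      (g := fun x : n.-tuple S => (tnth x p.1, tnth x p.2))).
    by apply: measurable_fun_pair; exact: measurable_tnth.
  apply/funext => x; rewrite big_enum pair_big_dep /=.
  by apply: eq_bigl => p; rewrite finset.inE.
- move=> x; rewrite lee_fin; apply: prodr_ge0 => i _; apply: prodr_ge0 => j _.
  exact: kernel_ge0.
Qed.

(** The kernel gives the probability of a copy of F on an initial segment; a
    copy elsewhere is an initial copy of a graph with more isolated
    vertices. *)
Lemma Ginfty_has_densities d (T : measurableType d) (P : probability T R)
    (G : {RV P >-> igraph}) : is_Ginfty Gam G -> has_densities Gam G.
Proof.
move=> [d1 [S [mu [W [d2 [T' [P' [X [G' [WG iidX sG GG']]]]]]]]]] F f f_inj.
pose m := (\max_i f i).+1.
have fm i : (f i < m)%N by rewrite ltnS; exact: leq_bigmax.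
pose f' i : 'I_m := Ordinal (fm i).
have f'_inj : injective f' by move=> i j [/f_inj].
rewrite (limit_density_push f'_inj) -WG -(kernel_densityE _ iidX sG).
have := GG' _ (measurable_contains (@nat_of_ord _ : 'I_(nverts (push_graph f'_inj)) -> nat)).
rewrite /distribution /pushforward => <-; congr (P (G @^-1` _)).
rewrite eqEsubset; split=> g /= H.
  by move=> a b /push_adjP[x [y [xy <- <-]]]; exact: H.
by move=> x y xy; apply: (H (f' x) (f' y)); apply/push_adjP; exists x, y.
Qed.

End Ginfty_density.


Definition edge_list_event (E : seq (nat * nat)) : set igraph :=
  [set g : igraph | forall p, p \in E -> g p.1 p.2].

Lemma measurable_edge_list E : measurable (edge_list_event E).
Proof.
apply: measurable_forall => p; exact: measurable_guard (measurable_edge _ _ _).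
Qed.

Lemma edge_list_cat E E' :
  edge_list_event (E ++ E') = edge_list_event E `&` edge_list_event E'.
Proof.
rewrite eqEsubset; split=> g /= H.
  by split=> p pE; apply: H; rewrite mem_cat pE ?orbT.
by move=> p; rewrite mem_cat => /orP[]; [exact: H.1|exact: H.2].
Qed.

Definition loopless (E : seq (nat * nat)) := all (fun p => p.1 != p.2) E.

Lemma edge_list_loop E : ~~ loopless E -> edge_list_event E = set0.
Proof.
case/allPn => p pE /negPn/eqP p12; rewrite -subset0 => g /(_ p pE) /=.
by rewrite p12 iadj_irr.
Qed.

Section edge_list_graph.
Variables (V : seq nat) (E : seq (nat * nat)).
Hypothesis V0 : (0 < size V)%N.

Definition edge_list_adj : rel 'I_(size V) := fun x y =>
  (x != y) && ((nth 0%N V x, nth 0%N V y) \in E) ||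
  (x != y) && ((nth 0%N V y, nth 0%N V x) \in E).

Lemma edge_list_adj_sym : symmetric edge_list_adj.
Proof. by move=> x y; rewrite /edge_list_adj eq_sym orbC. Qed.

Lemma edge_list_adj_irr : irreflexive edge_list_adj.
Proof. by move=> x; rewrite /edge_list_adj eqxx. Qed.

Definition edge_list_graph : sgraph :=
  SGraph V0 edge_list_adj_sym edge_list_adj_irr.

Hypothesis VE : forall p, p \in E -> p.1 \in V /\ p.2 \in V.

Lemma contains_edge_list : loopless E ->
  contains edge_list_graph (fun x => nth 0%N V x) = edge_list_event E.
Proof.
move=> /allP noloop; rewrite eqEsubset; split=> g /= H.
  move=> [a b] pE; have [aV bV] := VE pE.
  move: (aV) (bV); rewrite -!index_mem => ia ib.
  have := H (Ordinal ia) (Ordinal ib); rewrite /= !nth_index//; apply.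
  rewrite /edge_list_adj /= !nth_index// pE andbT; apply/orP; left.
  apply/eqP => -[e]; have := noloop _ pE => /=.
  by rewrite -[X in X != _](nth_index 0%N aV) e nth_index ?eqxx.
move=> x y /orP[/andP[_ /H]//|/andP[_ /H]/=].
by rewrite iadj_sym.
Qed.

End edge_list_graph.

(** The first vertex is always included: it is the root from which connected
    edge lists are explored. *)
Definition vertex_list (E : seq (nat * nat)) : seq nat :=
  undup (0%N :: [seq p.1 | p <- E] ++ [seq p.2 | p <- E]).

Lemma vertex_listP E p : p \in E -> p.1 \in vertex_list E /\ p.2 \in vertex_list E.
Proof.
move=> pE; rewrite !mem_undup !inE !mem_cat.
have m1 : p.1 \in [seq p.1 | p <- E] by exact: map_f.
have m2 : p.2 \in [seq p.2 | p <- E] by exact: map_f.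
by rewrite m1 m2 !orbT.
Qed.

Lemma mem_vertex_list E a : a \in vertex_list E ->
  a = 0%N \/ exists2 p, p \in E & a = p.1 \/ a = p.2.
Proof.
rewrite mem_undup inE mem_cat => /or3P[/eqP ->|/mapP[p pE ->]|/mapP[p pE ->]].
- by left.
- by right; exists p => //; left.
- by right; exists p => //; right.
Qed.

Lemma vertex_list0 E : 0%N \in vertex_list E.
Proof. by rewrite mem_undup mem_head. Qed.

Lemma vertex_list_gt0 E : (0 < size (vertex_list E))%N.
Proof. by rewrite -has_predT; apply/hasP; exists 0%N => //; exact: vertex_list0. Qed.

Lemma uniq_vertex_list E : uniq (vertex_list E).
Proof. exact: undup_uniq. Qed.

Definition rooted_graph (E : seq (nat * nat)) : sgraph :=
  edge_list_graph E (vertex_list_gt0 E).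

Lemma measurable_fun_igraph d (T : measurableType d) (h : T -> igraph) :
  (forall i j, measurable [set w | h w i j]) -> measurable_fun setT h.
Proof.
move=> mh; apply: (@measurability _ _ _ _ _ _ (range edge_event)) => //.
by move=> _ [_ [[i j] _ <-] <-]; rewrite setTI; exact: mh.
Qed.

Section laws_from_densities.
Context (R : realType) (Gam : graph_limit R).
Context d (T : measurableType d) (P : probability T R) (G : {RV P >-> igraph}).
Hypothesis GP : has_densities Gam G.

Lemma edge_list_density V E (V0 : (0 < size V)%N) : uniq V -> loopless E ->
  (forall p, p \in E -> p.1 \in V /\ p.2 \in V) ->
  P (G @^-1` edge_list_event E) = (Gam (edge_list_graph E V0))%:E.
Proof.
move=> uV noloop VE; rewrite -(GP (f := fun x => nth 0%N V x)).
  by rewrite contains_edge_list.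
by move=> x y /eqP; rewrite nth_uniq// => /eqP/val_inj.
Qed.

(** Containing the edges of a finite list is an event whose probability is a
    density, and these events form a pi-system that generates all others. *)
Lemma same_law d' (T' : measurableType d') (P' : probability T' R)
    (G' : {RV P' >-> igraph}) : has_densities Gam G' ->
  forall A, measurable A -> P (G @^-1` A) = P' (G' @^-1` A).
Proof.
move=> GP'.
pose C := [set edge_list_event E | E in setT].
have sub A : measurable A -> <<s C >> A.
  apply: smallest_sub; first exact: smallest_sigma_algebra.
  move=> _ [[i j] _ <-]; apply: sub_sigma_algebra; exists [:: (i, j)] => //.
  rewrite eqEsubset; split=> g /= H; first by apply: (H (i, j)); rewrite inE.
  by move=> p; rewrite inE => /eqP ->.
move=> A /sub; apply: (@probability_unique_on _ _ _
  (distribution P G) (distribution P' G')).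
- by move=> _ [E _ <-]; exact: measurable_edge_list.
- move=> _ _ [E _ <-] [E' _ <-]; exists (E ++ E') => //; exact: edge_list_cat.
- by exists [::] => //; rewrite eqEsubset; split.
- by rewrite /= /distribution /pushforward preimage_setT probability_setT ltry.
- move=> _ [E _ <-].
  rewrite -[LHS]/(P (G @^-1` _)) -[RHS]/(P' (G' @^-1` _)).
  case: (boolP (loopless E)) => [lE|/edge_list_loop ->]; last first.
    by rewrite !preimage_set0 !measure0.
  rewrite (edge_list_density (vertex_list_gt0 E) (uniq_vertex_list E) lE);
    last exact: vertex_listP.
  rewrite -(GP' _ (fun x => nth 0%N (vertex_list E) x)).
    by rewrite contains_edge_list//; exact: vertex_listP.
  by move=> x y /eqP; rewrite nth_uniq ?uniq_vertex_list// => /eqP/val_inj.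
Qed.

End laws_from_densities.

Lemma measurable_igraph_pull f : measurable_fun setT (igraph_pull f).
Proof. by apply: measurable_fun_igraph => i j; exact: measurable_edge. Qed.

(** Pulling back along an injection preserves all densities. Permutations of
    the vertices and the enumeration of an infinite set of vertices are both
    instances. *)
Lemma law_igraph_pull (R : realType) (Gam : graph_limit R)
    d (T : measurableType d) (P : probability T R) (G : {RV P >-> igraph})
    (f : nat -> nat) : has_densities Gam G -> injective f ->
  forall A, measurable A -> P (G @^-1` (igraph_pull f @^-1` A)) = P (G @^-1` A).
Proof.
move=> GP f_inj A mA.
have mpull : measurable_fun setT (igraph_pull f \o G).
  by apply: measurableT_comp => //; exact: measurable_igraph_pull.
apply/esym; apply: (@same_law _ _ _ _ _ _ GP _ _ _ (to_mfun mpull)) => //.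
move=> F h h_inj; rewrite -(GP F (f \o h)); last exact: inj_comp.
by congr (P _).
Qed.

(** * Sampled densities concentrate *)

Section sampled_density.
Context (R : realType).

Definition initial_graph (g : igraph) (n : nat) : sgraph :=
  @SGraph n.+1 (fun x y => g x y) isT (fun x y => iadj_sym g x y)
    (fun x => iadj_irr g x).

Lemma hom_initial_graph F g n (phi : {ffun 'I_(nverts F) -> 'I_n.+1}) :
  @is_hom F (initial_graph g n) phi <-> contains F (fun x => phi x : nat) g.
Proof. by split=> [/is_homP//|?]; apply/is_homP. Qed.

(** By the union bound over pairs, a random map is injective up to probability
    k^2 / N. *)
Lemma injective_fraction_ge (k N : nat) : (0 < N)%N ->
  1 - (k ^ 2)%:R / N%:R <= (N ^_ k)%:R / (N ^ k)%:R :> R.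
Proof.
move=> N0; have N0R : 0 < N%:R :> R by rewrite ltr0n.
elim: k => [|k IH]; first by rewrite expn0 ffactn0 divr1 mul0r subr0.
rewrite ffactnSr (expnSr N) !natrM -mulf_div.
set r := ((N ^_ k)%:R / _) in IH *; set s := ((N - k)%:R / _).
have r0 : 0 <= r by rewrite divr_ge0.
have r1 : r <= 1.
  rewrite ler_pdivrMr ?ltr0n ?expn_gt0 ?N0// mul1r ler_nat.
  have := card_inj_ffuns 'I_k 'I_N; rewrite !card_ord => <-.
  by rewrite (leq_trans (max_card _))// card_ffun !card_ord.
have sge : 1 - k%:R / N%:R <= s.
  rewrite /s ler_pdivlMr// mulrBl mul1r divfK ?gt_eqF// lerBlDr -natrD ler_nat.
  by rewrite addnC -leq_subLR.
have kk : (k.+1 ^ 2)%:R / N%:R >= (k ^ 2)%:R / N%:R + k%:R / N%:R :> R.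
  rewrite -mulrDl ler_pM2r ?invr_gt0// -natrD ler_nat; nia.
have b0 : 0 <= k%:R / N%:R :> R by rewrite divr_ge0.
have rb : r * (k%:R / N%:R) <= k%:R / N%:R by rewrite ler_piMl.
have rs : r * (1 - k%:R / N%:R) <= r * s by rewrite ler_wpM2l.
rewrite mulrBr mulr1 in rs; lra.
Qed.

Context (Gam : graph_limit R) d (T : measurableType d) (P : probability T R)
  (G : {RV P >-> igraph}).
Hypothesis GP : has_densities Gam G.

Definition sampled_density F n (w : T) : R :=
  hom_density R F (initial_graph (G w) n).

Definition mean_density F n : R :=
  (\sum_(phi : {ffun 'I_(nverts F) -> 'I_n.+1})
     fine (P (G @^-1` contains F (fun x => phi x : nat))))
    / (n.+1 ^ nverts F)%:R.

Lemma sampled_densityE F n w : sampled_density F n w =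
  (\sum_(phi : {ffun 'I_(nverts F) -> 'I_n.+1})
     \1_(G @^-1` contains F (fun x => phi x : nat)) w)
    / (n.+1 ^ nverts F)%:R.
Proof.
rewrite /sampled_density /hom_density card_ffun !card_ord; congr (_ / _).
rewrite -sum1_card natr_sum big_mkcond /=; apply: eq_bigr => phi _.
rewrite indicE; have [h|h] := pselect (contains F (fun x => phi x : nat) (G w)).
  by rewrite (mem_set (A := G @^-1` _) h) ifT// inE; exact/hom_initial_graph.
rewrite (memNset (A := G @^-1` _) h) ifF//; apply/negbTE/negP.
by rewrite inE => /hom_initial_graph.
Qed.

Lemma measurable_sampled_density F n : measurable_fun setT (sampled_density F n).
Proof.
have -> : sampled_density F n =
    (fun w => \sum_(phi : {ffun 'I_(nverts F) -> 'I_n.+1})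
      \1_(G @^-1` contains F (fun x => phi x : nat)) w)
    \* cst (n.+1 ^ nverts F)%:R^-1.
  exact/funext/sampled_densityE.
apply: measurable_funM; last exact: measurable_cst.
apply: measurable_sum => phi.
suff : measurable (G @^-1` contains F (fun x => phi x : nat)).
  by move=> mE; exact: measurable_indic.
by apply: measurable_RV_preimage; exact: measurable_contains.
Qed.

Lemma integral_sampled_density F n :
  (\int[P]_w (sampled_density F n w)%:E = (mean_density F n)%:E)%E.
Proof.
under eq_integral do rewrite sampled_densityE mulrC.
have mc phi : measurable (G @^-1` contains F (fun x => phi x : nat)).
  by apply: measurable_RV_preimage; exact: measurable_contains.
rewrite (eq_integral (fun w => ((n.+1 ^ nverts F)%:R^-1)%:E *
  \sum_(phi : {ffun 'I_(nverts F) -> 'I_n.+1})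
     (\1_(G @^-1` contains F (fun x => phi x : nat)) w)%:E)%E); last first.
  by move=> w _; rewrite EFinM sumEFin.
rewrite ge0_integralZl//; first last.
- by move=> w _; apply: sume_ge0 => phi _; rewrite lee_fin.
- apply: emeasurable_sum => phi; apply/measurable_EFinP.
  exact: measurable_indic.
rewrite ge0_integral_sum//; first last.
- by move=> phi; apply/measurable_EFinP; exact: measurable_indic.
rewrite /mean_density mulrC EFinM -sumEFin; congr (_ * _)%E.
apply: eq_bigr => phi _; rewrite integral_indic// setIT fineK//.
exact: fin_num_measure.
Qed.

(** An injective map hits a copy of F with probability exactly Gam F, and most
    maps are injective. *)
Lemma mean_density_near F n :
  `|mean_density F n - Gam F| <= (nverts F ^ 2)%:R / n.+1%:R.
Proof.
set k := nverts F; set N := n.+1.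
have Nk0 : 0 < (N ^ k)%:R :> R by rewrite ltr0n expn_gt0.
pose I := [set phi : {ffun 'I_k -> 'I_N} | injectiveb phi]%SET.
have cI : #|I| = (N ^_ k)%N by rewrite /I card_inj_ffuns !card_ord.
pose p (phi : {ffun 'I_k -> 'I_N}) : R :=
  fine (P (G @^-1` contains F (fun x => phi x : nat))).
have p01 phi : 0 <= p phi <= 1.
  rewrite fine_ge0//= -lee_fin fineK ?fin_num_measure ?probability_le1//;
    apply: measurable_RV_preimage; exact: measurable_contains.
have pI phi : phi \in I -> p phi = Gam F.
  rewrite finset.inE => /injectiveP inj_phi; rewrite /p GP//.
  by move=> x y /val_inj/inj_phi.
have Ec : #|[predC I]| = (N ^ k - N ^_ k)%N.
  by rewrite -cI; have := cardC I; rewrite card_ffun !card_ord => <-; rewrite addKn.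
have -> : mean_density F n - Gam F =
    (\sum_(phi | phi \notin I) (p phi - Gam F)) / (N ^ k)%:R.
  have {1}-> : Gam F = (\sum_(phi : {ffun 'I_k -> 'I_N}) Gam F) / (N ^ k)%:R.
    by rewrite sumr_const card_ffun !card_ord -(mulr_natr (Gam F)) mulfK// gt_eqF.
  rewrite /mean_density -mulrBl -sumrB (bigID (mem I))/= big1 ?add0r//.
  by move=> phi /pI; rewrite /p => ->; rewrite subrr.
rewrite normrM (gtr0_norm (x := _^-1)) ?invr_gt0//.
have sum_le : `|\sum_(phi | phi \notin I) (p phi - Gam F)| <=
    (N ^ k)%:R - (N ^_ k)%:R.
  apply: (le_trans (ler_norm_sum _ _ _)).
  apply: (@le_trans _ _ (\sum_(phi | phi \notin I) 1)).
    apply: ler_sum => phi _; have /andP[p0 p1] := p01 phi.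
    have := limit_density_ge0 Gam F; have := limit_density_le1 Gam F.
    by move=> g1 g0; rewrite ler_norml; apply/andP; split; lra.
  have -> : \sum_(phi | phi \notin I) 1 = #|[predC I]|%:R :> R.
    by rewrite -sum1_card natr_sum.
  rewrite Ec natrB// -cI (leq_trans (max_card _))// card_ffun !card_ord//.
apply: (le_trans (y := ((N ^ k)%:R - (N ^_ k)%:R) / (N ^ k)%:R)).
  by rewrite ler_pM2r ?invr_gt0.
rewrite mulrBl divff ?gt_eqF// lerBlDl -lerBlDr.
exact: injective_fraction_ge.
Qed.

(** The square of a density of F is the density of two disjoint copies of F,
    so both moments are close to those of the constant Gam F; the two errors
    are at most 4 k^2 / N and 2 k^2 / N. *)
Lemma second_moment F n :
  (\int[P]_w (((sampled_density F n w - Gam F) ^+ 2)%:E) <=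
   (6 * (nverts F ^ 2)%:R / n.+1%:R)%:E)%E.
Proof.
set g := Gam F; set I := (\int[P]_w _)%E.
have g0 : 0 <= g by exact: limit_density_ge0.
have g1 : g <= 1 by exact: limit_density_le1.
have mt F' := measurable_sampled_density F' n.
have t0 F' w : 0 <= sampled_density F' n w by exact: hom_density_ge0.
have key : (I + (2 * g)%:E * (mean_density F n)%:E =
    (mean_density (dunion F F) n)%:E + (g ^+ 2)%:E)%E.
  rewrite -!integral_sampled_density.
  have -> : ((g ^+ 2)%:E = \int[P]_w (g ^+ 2)%:E)%E.
    by rewrite integral_cst//= probability_setT mule1.
  rewrite -ge0_integralZl//; first last.
  - by rewrite lee_fin mulr_ge0.
  - by move=> w _; rewrite lee_fin.
  - exact/measurable_EFinP.
  rewrite -ge0_integralD//; first last.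
  - by apply: emeasurable_funM => //; exact/measurable_EFinP.
  - by move=> w _; rewrite -EFinM lee_fin !mulr_ge0.
  - by apply/measurable_EFinP; apply: measurable_funX; exact: measurable_funB.
  - by move=> w _; rewrite lee_fin sqr_ge0.
  rewrite -ge0_integralD//; first last.
  - by move=> w _; rewrite lee_fin sqr_ge0.
  - exact/measurable_EFinP.
  - by move=> w _; rewrite lee_fin.
  apply: eq_integral => w _; rewrite -EFinM -!EFinD; congr (_%:E).
  have -> : sampled_density (dunion F F) n w = sampled_density F n w ^+ 2.
    by rewrite /sampled_density hom_density_dunion expr2.
  rewrite sqrrB; lra.
have Ifin : I \is a fin_num.
  have := congr1 (fun x => x \is a fin_num) key.
  by rewrite !fin_numD /= andbT.
rewrite -[I]fineK// lee_fin; move: key.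
rewrite -[I]fineK// -EFinM -!EFinD => -[key].
have m1 := mean_density_near F n.
have m2 := mean_density_near (dunion F F) n.
rewrite limit_density_dunion -/g /= in m1 m2.
have kk : ((nverts F + nverts F) ^ 2)%:R / n.+1%:R = 4 * ((nverts F ^ 2)%:R / n.+1%:R) :> R.
  by rewrite mulrA -natrM addnn -mul2n expnMn.
rewrite kk in m2; rewrite -mulrA.
set q := (_ / _) in m1 m2 *.
move: m1 m2; rewrite !ler_norml => /andP[a1 a2] /andP[b1 b2].
have : g * (mean_density F n - g) >= g * - q by rewrite ler_wpM2l.
have q0 : 0 <= q by rewrite divr_ge0.
have : g * q <= q by rewrite ler_piMl.
rewrite expr2 in key; nra.
Qed.

Lemma measurable_sampled_density_far F n (delta : R) :
  measurable [set w | delta <= `|sampled_density F n w - Gam F|].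
Proof.
rewrite (_ : [set w | _] =
    (fun w => `|sampled_density F n w - Gam F|) @^-1` `[delta, +oo[).
  rewrite -[X in measurable X]setTI.
  have mB : measurable_fun setT (fun w => sampled_density F n w - Gam F).
    by apply: measurable_funB => //; exact: measurable_sampled_density.
  by have := measurableT_comp (@normr_measurable R setT) mB; apply.
by rewrite eqEsubset; split=> w /=; rewrite in_itv /= andbT.
Qed.

(** Chebyshev's inequality. *)
Lemma sampled_density_far F n (delta : R) : 0 < delta ->
  (P [set w | (delta <= `|sampled_density F n w - Gam F|)%R] <=
   (6 * (nverts F ^ 2)%:R / delta ^+ 2 / n.+1%:R)%:E)%E.
Proof.
move=> d0; set A := [set w | _].
have mt := measurable_sampled_density F n.
have mA : measurable A by exact: measurable_sampled_density_far.
have d2 : 0 < delta ^+ 2 by rewrite exprn_gt0.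
have mf : measurable_fun setT (fun w => ((sampled_density F n w - Gam F) ^+ 2)%:E).
  by apply/measurable_EFinP; apply: measurable_funX; exact: measurable_funB.
have : ((delta ^+ 2)%:E * P A <= (6 * (nverts F ^ 2)%:R / n.+1%:R)%:E)%E.
  apply: le_trans (second_moment F n).
  rewrite -integral_cst//.
  apply: (@le_trans _ _ (\int[P]_(w in A) ((sampled_density F n w - Gam F) ^+ 2)%:E)%E).
    apply: ge0_le_integral => //.
    - by move=> w _; rewrite lee_fin ltW.
    - exact: measurable_funS mf.
    - move=> w Aw; rewrite lee_fin -[leRHS]real_normK ?num_real//.
      by rewrite lerXn2r// ?nnegrE ?ltW.
  by apply: ge0_subset_integral => // w _; rewrite lee_fin sqr_ge0.
rewrite -(fineK (fin_num_measure P _ mA)) -EFinM !lee_fin => H.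
by rewrite mulrAC ler_pdivlMr// mulrC.
Qed.

End sampled_density.

(** * Cutting a finite graph along a closed set of vertices *)

Section cut.
Variables (g : sgraph).
Implicit Types C : {set 'I_(nverts g)}.

Definition closed_set C := forall x y : 'I_(nverts g), adj x y -> x \in C -> y \in C.

Lemma closed_setC C : closed_set C -> closed_set (~: C)%SET.
Proof.
move=> clC x y xy; rewrite !finset.in_setC; apply: contra.
by apply: clC; rewrite adj_sym.
Qed.

Definition induced C (C0 : (0 < #|C|)%N) : sgraph :=
  @SGraph #|C| (fun x y => adj (enum_val x) (enum_val y)) C0
    (fun x y => adj_sym (enum_val x) (enum_val y)) (fun x => adj_irr (enum_val x)).

Lemma card_hom_into C (C0 : (0 < #|C|)%N) F :
  #|[pred phi | @is_hom F g phi && [forall x, phi x \in C]]| =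
  #|[pred f | @is_hom F (induced C0) f]|.
Proof.
pose h (f : {ffun 'I_(nverts F) -> 'I_#|C|}) : {ffun 'I_(nverts F) -> 'I_(nverts g)} :=
  [ffun x => enum_val (f x)].
have h_inj : injective h.
  move=> f f' E; apply/ffunP => x; apply: enum_val_inj.
  have E' y : h f y = h f' y by rewrite E.
  by have := E' x; rewrite !ffunE.
rewrite -(fintype.card_image h_inj); apply: eq_card => phi.
apply/idP/fintype.imageP => [|[f]].
  rewrite inE => /andP[/is_homP hphi /forallP inC].
  exists [ffun x => enum_rank_in (inC x) (phi x)].
    rewrite inE; apply/is_homP => x y xy; rewrite !ffunE /=.
    by rewrite !enum_rankK_in//; exact: hphi.
  by apply/ffunP => x; rewrite !ffunE enum_rankK_in.
rewrite inE => /is_homP hf ->; rewrite inE; apply/andP; split.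
  by apply/is_homP => x y xy; rewrite !ffunE; exact: hf.
by apply/forallP => x; rewrite ffunE enum_valP.
Qed.

Context (R : realType).

Lemma hom_density_induced C (C0 : (0 < #|C|)%N) F :
  (#|C|%:R / (nverts g)%:R) ^+ nverts F * hom_density R F (induced C0) =
  #|[pred phi | @is_hom F g phi && [forall x, phi x \in C]]|%:R /
  #|{: {ffun 'I_(nverts F) -> 'I_(nverts g)}}|%:R.
Proof.
rewrite card_hom_into /hom_density !card_ffun !card_ord !natrX.
have c0 : #|C|%:R ^+ nverts F != 0 :> R by rewrite expf_neq0// pnatr_eq0 -lt0n.
by rewrite expr_div_n mulrC mulrA divfK.
Qed.

(** A homomorphic image of a connected graph cannot meet both sides of a
    closed set, so for connected graphs the homomorphisms into the two sides
    exhaust all homomorphisms. *)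
Lemma hom_density_cut C (C0 : (0 < #|C|)%N) (D0 : (0 < #|(~: C)%SET|)%N) F :
  closed_set C -> sgraph_connected F ->
  hom_density R F g =
  (#|C|%:R / (nverts g)%:R) ^+ nverts F * hom_density R F (induced C0) +
  (1 - #|C|%:R / (nverts g)%:R) ^+ nverts F * hom_density R F (induced D0).
Proof.
move=> clC cF.
have -> : 1 - #|C|%:R / (nverts g)%:R = #|(~: C)%SET|%:R / (nverts g)%:R :> R.
  have n0 : (nverts g)%:R != 0 :> R by rewrite gt_eqF// nverts_gt0R.
  rewrite -{1}(divff n0) -mulrBl; congr (_ / _).
  have := cardsC C; rewrite card_ord => {1}<-.
  by rewrite natrD addrAC subrr add0r.
rewrite !hom_density_induced -mulrDl /hom_density; congr (_ / _).
rewrite -natrD -(cardID [pred phi : {ffun 'I_(nverts F) -> 'I_(nverts g)} |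
  [forall x, phi x \in C]]); congr (_ + _)%:R.
apply: eq_card => phi; rewrite !inE.
case: (boolP (is_hom phi)) => /=; rewrite ?andbF// => /is_homP hphi; rewrite andbT.
have prop D : closed_set D -> forall x, phi x \in D -> forall y, phi y \in D.
  move=> clD x xD y.
  have /forallP/(_ x)/forallP/(_ y)/connectP[p px ->] := cF.
  elim: p x xD px => //= z p IH x xD /andP[xz zp].
  by apply: IH zp; apply: clD xD; exact: hphi.
apply/idP/forallP => [|H].
  move=> /forallPn[x xC]; apply: (prop _ (closed_setC clC) x).
  by rewrite finset.in_setC.
apply/forallPn; exists (Ordinal (nverts_gt0 F)).
by have := H (Ordinal (nverts_gt0 F)); rewrite finset.in_setC.
Qed.

End cut.

(** * Connected graph limits have no balanced cuts *)

Lemma sgraph_eq (F F' : sgraph) (e : nverts F = nverts F') :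
  (forall x y, @adj F x y = @adj F' (cast_ord e x) (cast_ord e y)) -> F = F'.
Proof.
case: F e => n r n0 rs ri; case: F' => n' r' n0' rs' ri' /= e.
case: n' / e r' n0' rs' ri' => r' n0' rs' ri' E.
have rr : r = r'.
  by apply/funext => x; apply/funext => y; rewrite E !cast_ord_id.
case: r' / rr rs' ri' E => rs' ri' _.
by congr SGraph; exact: Prop_irrelevance.
Qed.

Lemma sgraph_countable : exists e : nat -> sgraph, forall F, exists j, e j = F.
Proof.
pose code (F : sgraph) : nat * seq (nat * nat) := (nverts F,
  [seq (val p.1, val p.2) | p <- enum [pred p : 'I_(nverts F) * 'I_(nverts F) | adj p.1 p.2]]).
have codeE F x y : @adj F x y = ((val x, val y) \in (code F).2).
  apply/idP/mapP => [xy|[[x' y']]]; first by exists (x, y) => //; rewrite mem_enum.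
  by rewrite mem_enum inE /= => xy [/val_inj -> /val_inj ->].
have code_inj F F' : code F = code F' -> F = F'.
  move=> E; have e : nverts F = nverts F' by case: E.
  by apply: (sgraph_eq (e := e)) => x y; rewrite !codeE E.
have /choice[e eP] : forall j, exists F,
    (exists F', pickle (code F') = j) -> pickle (code F) = j.
  move=> j; have [[F FE]|nF] := pselect (exists F', pickle (code F') = j).
    by exists F.
  by exists (edgeless 0) => /nF.
exists e => F; exists (pickle (code F)); apply: code_inj.
by apply: (pcan_inj pickleK); apply: eP; exists F.
Qed.

(** A cluster point exists by compactness of [0, 1], and of any neighbourhood
    and its complement the ultrafilter selects one. *)
Lemma ultra_limit (R : realType) (U : set_system nat) (x : nat -> R) :
  UltraFilter U -> (forall n, 0 <= x n <= 1) ->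
  exists l, forall eps, 0 < eps -> U [set n | `|x n - l| < eps].
Proof.
move=> UU x01.
have xU : (x @ U) `[0, 1]%classic.
  rewrite /fmap /= (_ : _ @^-1` _ = setT); first exact: filterT.
  by rewrite eqEsubset; split=> n //= _; rewrite in_itv /=; exact: x01.
have [l [_ cl]] := @segment_compact R 0 1 _ _ xU.
exists l => eps eps0.
have [//|UC] := @in_ultra_setVsetC _ U [set n | `|x n - l| < eps] UU.
have xC : (x @ U) (~` ball l eps).
  rewrite /fmap /=; apply: filterS UC => n /= H xb; apply: H.
  by move: xb; rewrite -ball_normE /= distrC.
have [y [yC yb]] := cl _ _ xC (nbhsx_ballx l eps eps0).
by [].
Qed.

(** Any finitely many of the countably many sequences are simultaneously close
    to their limits along an ultrafilter, on a set of indices that belongs to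
    the ultrafilter and hence is unbounded; choose from these sets in turn. *)
Lemma joint_subsequence (R : realType) (I : Type) (e : nat -> I)
    (x : nat -> I -> R) :
  (forall i, exists j, e j = i) -> (forall n i, 0 <= x n i <= 1) ->
  exists (l : I -> R) (s : nat -> nat), (forall n, (n <= s n)%N) /\
  forall i, x (s n) i @[n --> \oo] --> l i.
Proof.
move=> e_surj x01.
have [U [UU ooU]] := @ultraFilterLemma _ (\oo : set_system nat) _.
have /choice[l lP] : forall i, exists l, forall eps, 0 < eps ->
    U [set n | `|x n i - l| < eps].
  by move=> i; apply: ultra_limit => // n; exact: x01.
have /choice[s sP] : forall n, exists m, (n <= m)%N /\
    forall j, (j < n)%N -> `|x m (e j) - l (e j)| < n.+1%:R^-1.
  move=> n.
  have : U ([set m | (n <= m)%N] `&` \bigcap_(j in `I_n)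
      [set m | `|x m (e j) - l (e j)| < n.+1%:R^-1]).
    apply: filterI; first by apply: ooU; exists n.
    elim: (X in `I_X) => [|k IH]; first by rewrite II0 bigcap_set0; exact: filterT.
    rewrite IIS bigcap_setU bigcap_set1; apply: filterI => //.
    by apply: lP; rewrite invr_gt0.
  by move=> /filter_ex[m [/= nm H]]; exists m.
exists l, s; split => [n|i]; first by have [] := sP n.
have [j <-] := e_surj i.
apply/cvgrPdist_lt => eps eps0.
have : \forall n \near \oo, n.+1%:R^-1 < eps.
  exact: (near_infty_natSinv_lt (PosNum eps0)).
apply: filterS2 (nbhs_infty_gt j) => n jn neps.
rewrite distrC; apply: lt_trans neps; exact: (sP n).2.
Qed.

Lemma sum_le_size2 (R : realType) (f : nat -> \bar R) :
  (\sum_(1 <= i <oo | le_size i (Some 2%N)) f i = f 1%N + f 2%N)%E.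
Proof.
apply: lim_near_cst => //; near=> n.
have n3 : (3 <= n)%N by near: n; exists 3%N.
rewrite (big_cat_nat (n := 3))//= [X in (_ + X)%E]big_nat_cond.
rewrite [X in (_ + X)%E]big_pred0 ?adde0; last first.
  by move=> i; rewrite /le_size; case: ltnP => //=; rewrite ?andbF// => i3;
     rewrite ltnNge i3/= ?andbF.
by rewrite big_ltn_cond//= big_ltn_cond//= big_geq// adde0.
Unshelve. all: by end_near. Qed.

Section no_balanced_cut.
Context (R : realType) (Gam : graph_limit R) (e : nat -> sgraph).
Hypothesis e_surj : forall F, exists j, e j = F.

(** Along a subsequence the proportion of C n and the densities of both parts
    converge. The identity between the densities of a connected graph in g n
    and in the two parts then passes to the limit. *)
Lemma disconnected_of_cuts (eps : R) (g : nat -> sgraph)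
    (C : forall n, {set 'I_(nverts (g n))}) : 0 < eps ->
  (forall n, (n <= nverts (g n))%N) ->
  (forall n j, (j < n)%N ->
     `|hom_density R (e j) (g n) - Gam (e j)| < n.+1%:R^-1) ->
  (forall n, closed_set (C n)) ->
  (forall n, eps <= #|C n|%:R / (nverts (g n))%:R *
                    (1 - #|C n|%:R / (nverts (g n))%:R)) ->
  disconnected_limit Gam.
Proof.
move=> eps0 gn gGam clC cutC.
pose a n : R := #|C n|%:R / (nverts (g n))%:R.
have N0 n : 0 < (nverts (g n))%:R :> R by exact: nverts_gt0R.
have aE n : a n * (nverts (g n))%:R = #|C n|%:R by rewrite /a divfK ?gt_eqF.
have bE n : (1 - a n) * (nverts (g n))%:R = #|(~: C n)%SET|%:R.
  rewrite mulrBl aE mul1r; apply/eqP; rewrite subr_eq -natrD addnC.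
  by rewrite cardsC card_ord.
have a01 n : 0 <= a n <= 1.
  rewrite divr_ge0//= ler_pdivrMr// mul1r ler_nat.
  by rewrite (leq_trans (max_card _))// card_ord.
have aeps n : eps <= a n by have := cutC n; rewrite -/(a n); have := a01 n; nra.
have beps n : eps <= 1 - a n by have := cutC n; rewrite -/(a n); have := a01 n; nra.
have C0 n : (0 < #|C n|)%N.
  by rewrite -(ltr0n R) -aE mulr_gt0// (lt_le_trans eps0).
have D0 n : (0 < #|(~: C n)%SET|)%N.
  by rewrite -(ltr0n R) -bE mulr_gt0// (lt_le_trans eps0).
pose x n (i : option (bool * sgraph)) : R := match i with
  | None => a n
  | Some (true, F) => hom_density R F (induced (C0 n))
  | Some (false, F) => hom_density R F (induced (D0 n)) end.
(* One index type for the three families of bounded sequences. *)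
pose e' j : option (bool * sgraph) :=
  if unpickle j is Some (Some (b, k)) then Some (b : bool, e k) else None.
have e'_surj i : exists j, e' j = i.
  case: i => [[b F]|].
    have [k ekF] := e_surj F; exists (pickle (Some (b, k))).
    by rewrite /e' pickleK ekF.
  by exists (pickle (None : option (bool * nat))); rewrite /e' pickleK.
have x01 n i : 0 <= x n i <= 1.
  by case: i => [[[] F]|] /=; rewrite ?hom_density_ge0 ?hom_density_le1//; exact: a01.
have [l [s [sn xl]]] := joint_subsequence e'_surj x01.
have grow (h : nat -> sgraph) : (forall n, eps * n%:R <= (nverts (h n))%:R :> R) ->
    nverts (h n) @[n --> \oo] --> \oo.
  move=> hn A [M _ MA]; have [k Mk] : exists k : nat, M%:R / eps <= k%:R :> R.
    by exists (Num.truncn (M%:R / eps)).+1; rewrite ltW// truncnS_gt.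
  exists k => // n /= kn; apply: MA => /=; rewrite -(ler_nat R).
  apply: le_trans (hn n); rewrite -ler_pdivrMl// mulrC.
  by apply: (le_trans Mk); rewrite ler_nat.
have sR n : n%:R <= (nverts (g (s n)))%:R :> R.
  by rewrite ler_nat (leq_trans (sn n))// gn.
have lim1P : exists Gs : nat -> sgraph, (nverts (Gs n) @[n --> \oo] --> \oo) /\
    forall F, hom_density R F (Gs n) @[n --> \oo] --> l (Some (true, F)).
  exists (fun n => induced (C0 (s n))); split; last by move=> F; exact: xl.
  apply: grow => n /=; rewrite -aE; apply: ler_pM => //; exact: ltW.
have lim2P : exists Gs : nat -> sgraph, (nverts (Gs n) @[n --> \oo] --> \oo) /\
    forall F, hom_density R F (Gs n) @[n --> \oo] --> l (Some (false, F)).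
  exists (fun n => induced (D0 (s n))); split; last by move=> F; exact: xl.
  apply: grow => n /=; rewrite -bE; apply: ler_pM => //; exact: ltW.
pose al := l None.
have al_cvg : a (s n) @[n --> \oo] --> al by exact: (xl None).
have al1 : eps <= al.
  rewrite -(cvg_lim _ al_cvg)//; apply: limr_ge; first by apply/cvg_ex; exists al.
  by near=> n; exact: aeps.
have al2 : al <= 1 - eps.
  rewrite -(cvg_lim _ al_cvg)//; apply: limr_le; first by apply/cvg_ex; exists al.
  by near=> n; have := beps (s n); lra.
exists (GraphLimit lim1P), (GraphLimit lim2P), al; split.
  by rewrite (lt_le_trans eps0)//= (le_lt_trans al2)// ltrBlDr ltrDl.
move=> F cF _; rewrite sum_le_size2 -EFinD; congr (_%:E) => /=.
have cvgGam : hom_density R F (g (s n)) @[n --> \oo] --> Gam F.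
  have [j <-] := e_surj F; apply/cvgrPdist_lt => del del0.
  have : \forall n \near \oo, n.+1%:R^-1 < del.
    exact: (near_infty_natSinv_lt (PosNum del0)).
  apply: filterS2 (nbhs_infty_gt j) => n jn ndel.
  rewrite distrC; apply: lt_trans (gGam _ _ (leq_trans jn (sn n))) _.
  by apply: le_lt_trans ndel; rewrite lef_pV2 ?posrE ?ltr0n// ler_nat ltnS.
apply: (cvg_unique _ cvgGam) => //.
rewrite (_ : (fun n => _) = (fun n =>
    a (s n) ^+ nverts F * x (s n) (Some (true, F)) +
    (1 - a (s n)) ^+ nverts F * x (s n) (Some (false, F)))); last first.
  by apply/funext => n; exact: hom_density_cut.
have cvg_pow (u : nat -> R) (c : R) k : u n @[n --> \oo] --> c ->
    u n ^+ k @[n --> \oo] --> c ^+ k.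
  move=> uc; elim: k => [|k IH]; first exact: cvg_cst.
  rewrite exprS (_ : (fun n => _) = (fun n => u n * u n ^+ k)); first exact: cvgM.
  by apply/funext => n; rewrite exprS.
apply: cvgD; apply: cvgM; try exact: xl; apply: cvg_pow => //.
by apply: cvgB => //; exact: cvg_cst.
Unshelve. all: by end_near. Qed.

Hypothesis Gam_conn : connected_limit Gam.

(** Closeness in finitely many densities describes a neighbourhood of Gam. If
    every such neighbourhood contained arbitrarily large graphs with balanced
    cuts, these would converge to Gam and disconnect it. *)
Lemma no_balanced_cut (eps : R) : 0 < eps -> exists K, forall g : sgraph,
  (K <= nverts g)%N ->
  (forall j, (j < K)%N -> `|hom_density R (e j) g - Gam (e j)| < K.+1%:R^-1) ->
  forall C : {set 'I_(nverts g)}, closed_set C ->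
  #|C|%:R / (nverts g)%:R * (1 - #|C|%:R / (nverts g)%:R) < eps.
Proof.
move=> eps0; apply: contrapT => noK; apply: Gam_conn.
have /choice[gC gCP] : forall n, exists gC : {g : sgraph & {set 'I_(nverts g)}},
    [/\ (n <= nverts (projT1 gC))%N,
     forall j, (j < n)%N ->
       `|hom_density R (e j) (projT1 gC) - Gam (e j)| < n.+1%:R^-1,
     closed_set (projT2 gC) &
     eps <= #|projT2 gC|%:R / (nverts (projT1 gC))%:R *
            (1 - #|projT2 gC|%:R / (nverts (projT1 gC))%:R)].
  move=> n; apply: contrapT => ngC; apply: noK; exists n => g ng gj C clC.
  rewrite ltNge; apply/negP => bad; apply: ngC.
  by exists (existT _ g C).
apply: (@disconnected_of_cuts eps (fun n => projT1 (gC n)) (fun n => projT2 (gC n))) => //.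
- by move=> n; case: (gCP n).
- by move=> n j; case: (gCP n) => _ + _ _; apply.
- by move=> n; case: (gCP n).
- by move=> n; case: (gCP n).
Qed.

(** If all densities of graphs with edges vanish, then Gam is a direct sum of
    two copies of itself. *)
Lemma connected_limit_nontrivial :
  exists F, (0 < size_edges F)%N /\ 0 < Gam F.
Proof.
apply: contrapT => noF; apply: Gam_conn.
have Gam0 F : (0 < size_edges F)%N -> Gam F = 0.
  move=> F0; apply/eqP; rewrite eq_le limit_density_ge0 andbT leNgt.
  by apply/negP => GF; apply: noF; exists F.
exists Gam, Gam, 2^-1; split; first by lra.
by move=> F cF F0; rewrite sum_le_size2 /= Gam0// !mulr0 adde0.
Qed.

End no_balanced_cut.

(** * Connectivity of the infinite graph *)

(** Components as least closed sets: in this form, statements about components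
    are proved by exhibiting closed sets instead of paths. *)
Lemma component_closedP (g : igraph) v u : component g v u <->
  forall D : set nat, (forall a b, g a b -> D a -> D b) -> D v -> D u.
Proof.
split=> [[p pp <-] D clD|H].
  by elim: p v pp => //= a p IH v /andP[va /IH ap] /(clD _ _ va).
apply: H; last by exists [::].
move=> a b ab [p pp pa]; exists (rcons p b); rewrite ?last_rcons//.
by rewrite rcons_path pp pa.
Qed.

Lemma component_refl g v : component g v v.
Proof. by exists [::]. Qed.

Lemma component_trans g u v w : component g u v -> component g v w -> component g u w.
Proof.
move=> /component_closedP uv /component_closedP vw; apply/component_closedP.
by move=> D clD Du; exact: vw clD (uv _ clD Du).
Qed.

Lemma component_edge (g : igraph) u v : g u v -> component g u v.
Proof. by move=> uv; exists [:: v] => //=; rewrite uv. Qed.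

Lemma component_sym g u v : component g u v -> component g v u.
Proof.
move=> /component_closedP uv; apply: (uv (fun x => component g x u)).
  move=> a b ab; apply: component_trans; apply: component_edge.
  by rewrite iadj_sym.
exact: component_refl.
Qed.

Lemma component_pull g (f h : nat -> nat) : cancel f h -> cancel h f ->
  forall u v, component (igraph_pull f g) u v <-> component g (f u) (f v).
Proof.
move=> fK hK u v; split => /component_closedP H; apply/component_closedP => D clD.
  by apply: (H (fun x => D (f x))) => a b; exact: clD.
move=> Du; rewrite -(fK v); apply: (H (fun x => D (h x))); rewrite ?fK//.
by move=> a b ab; apply: clD; rewrite /= !hK.
Qed.

Lemma measurable_path p v : measurable [set g : igraph | path g v p].
Proof.
elim: p v => [|a p IH] v /=; first by rewrite (_ : [set _ | _] = setT)// eqEsubset.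
rewrite (_ : [set _ | _] = [set g : igraph | g v a = true] `&` [set g : igraph | path g a p]).
  by apply: measurableI => //; exact: measurable_edge.
by rewrite eqEsubset; split=> g /=; [move=> /andP[]|move=> [-> ->]].
Qed.

Lemma measurable_component v u : measurable [set g | component g v u].
Proof.
rewrite (_ : [set g | _] = [set g : igraph | exists p : seq nat,
    [set g' : igraph | last v p = u /\ path g' v p] g]).
  by apply: measurable_exists => p; exact: measurable_constI (measurable_path p v).
rewrite eqEsubset; split=> g /=; first by move=> [p pp pu]; exists p.
by move=> [p [pu pp]]; exists p.
Qed.

Definition transpose (a b x : nat) : nat :=
  if x == a then b else if x == b then a else x.

Lemma transposeK a b : involutive (transpose a b).
Proof.
move=> x; rewrite /transpose; case: (eqVneq x a) => [->|xa].
  by rewrite eqxx; case: eqP.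
case: (eqVneq x b) => [->|xb]; first by rewrite eqxx.
by rewrite (negbTE xa) (negbTE xb).
Qed.

Lemma transposeL a b : transpose a b a = b.
Proof. by rewrite /transpose eqxx. Qed.

Lemma transposeN a b x : x != a -> x != b -> transpose a b x = x.
Proof. by rewrite /transpose => /negbTE -> /negbTE ->. Qed.

Lemma transpose_eq a b x y : (transpose a b x == y) = (x == transpose a b y).
Proof. by rewrite -(inj_eq (can_inj (transposeK a b))) transposeK. Qed.

(** With exchangeability, this makes all triples of distinct vertices equally
    likely to be split. *)
Lemma triple_bijection v i j : v != i -> v != j -> i != j ->
  exists f h : nat -> nat,
  [/\ cancel f h, cancel h f, f 0%N = v, f 1%N = i & f 2%N = j].
Proof.
move=> vi vj ij.
pose i' := transpose 0 v i.
pose j' := transpose 1 i' (transpose 0 v j).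
have i'0 : i' != 0%N by rewrite /i' transpose_eq transposeL eq_sym.
have j'0 : j' != 0%N.
  rewrite /j' transpose_eq (@transposeN 1 i' 0)//.
    by rewrite transpose_eq transposeL eq_sym.
  by rewrite eq_sym.
have j'1 : j' != 1%N.
  by rewrite /j' transpose_eq transposeL /i' transpose_eq transposeK eq_sym.
have E2 : transpose 2 j' 2 = j' by exact: transposeL.
exists (transpose 0 v \o (transpose 1 i' \o transpose 2 j')).
exists ((transpose 2 j' \o transpose 1 i') \o transpose 0 v).
have j'N k : k != 2%N -> j' != k -> transpose 2 j' k = k.
  by move=> k2 jk; rewrite transposeN// eq_sym.
split => [x|x|||]; rewrite /comp.
- by rewrite !transposeK.
- by rewrite !transposeK.
- by rewrite j'N// (@transposeN 1 i' 0) ?transposeL// eq_sym.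
- by rewrite j'N// transposeL transposeK.
- by rewrite E2 !transposeK.
Qed.

Definition splits v i j : set igraph :=
  [set g | component g v i /\ ~ component g v j].

Lemma measurable_splits v i j : measurable (splits v i j).
Proof.
apply: measurableI; first exact: measurable_component.
exact: measurableC (measurable_component v j).
Qed.

Section splitting_events.
Context (R : realType) (Gam : graph_limit R) d (T : measurableType d)
  (P : probability T R) (G : {RV P >-> igraph}).
Hypothesis GP : has_densities Gam G.

Lemma prob_splits v i j : v != i -> v != j -> i != j ->
  P (G @^-1` splits v i j) = P (G @^-1` splits 0 1 2).
Proof.
move=> vi vj ij; have [f [h [fK hK <- <- <-]]] := triple_bijection vi vj ij.
rewrite -(law_igraph_pull GP (can_inj fK) (measurable_splits 0 1 2)).
congr (P (G @^-1` _)); apply/seteqP; split=> g [H1 H2]; split.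
- exact/(component_pull _ fK hK).
- by move=> /(component_pull _ fK hK).
- exact/(component_pull _ fK hK).
- by move=> H; apply: H2; exact/(component_pull _ fK hK).
Qed.

Hypothesis Gam_conn : connected_limit Gam.

Lemma component_closed_initial g n :
  closed_set (g := initial_graph g n)
    [set i : 'I_n.+1 | `[< component g 0 i >]]%SET.
Proof.
move=> x y xy; rewrite !finset.inE => /asboolP x0; apply/asboolP.
exact: component_trans x0 (component_edge xy).
Qed.

(** The component C of the first vertex restricted to an initial graph is
    closed, so for most initial graphs it is almost everything or almost
    nothing; then few pairs (i, j) have i in C and j outside C. But by
    exchangeability all these pairs of distinct vertices, apart from the first
    vertex, have the same probability p of being of this kind. *)
Lemma prob_splits0 : P (G @^-1` splits 0 1 2) = 0%E.
Proof.
have mS v i j : measurable (G @^-1` splits v i j).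
  exact: measurable_RV_preimage (measurable_splits v i j).
have Pfin A : measurable A -> P A \is a fin_num by exact: fin_num_measure.
set p0 := P _; rewrite -[p0]fineK ?Pfin//; set p := fine p0; congr (_%:E).
have p0ge : 0 <= p by exact: fine_ge0 (measure_ge0 _ _).
apply/eqP; rewrite eq_le p0ge andbT leNgt; apply/negP => p_gt0.
have [e e_surj] := sgraph_countable.
have eps0 : 0 < p / 24 by rewrite divr_gt0.
have [K KP] := no_balanced_cut e_surj Gam_conn eps0.
pose c : R := \sum_(j < K) 6 * (nverts (e j) ^ 2)%:R / K.+1%:R^-1 ^+ 2.
(* Bounding the expected number of split pairs from both sides gives
   n (n - 1) p <= N^2 (p / 24 + p / 24) with N = n + 1 >= 3, whereas
   N^2 <= 6 n (n - 1). *)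
have [n [nK n2 cn]] : exists n, [/\ (K <= n)%N, (2 <= n)%N & c / n.+1%:R <= p / 24].
  exists (maxn (maxn K 2) (Num.truncn (c / (p / 24))).+1).
  set t := Num.truncn _; split; [lia|lia|].
  rewrite ler_pdivrMr ?ltr0n// mulrC -ler_pdivrMr//.
  apply: (@le_trans _ _ t.+1%:R); first exact/ltW/truncnS_gt.
  by rewrite ler_nat; lia.
pose N := n.+1; have N0 : 0 < N%:R :> R by rewrite ltr0n.
pose far j := [set w | (K.+1%:R^-1 <= `|sampled_density G (e j) n w - Gam (e j)|)].
have mfar j : measurable (far j).
  exact: measurable_sampled_density_far.
pose bad := \bigcup_(j in `I_K) far j.
have mbad : measurable bad by apply: bigcup_measurable => j _; exact: mfar.
have Pbad : (P bad <= (p / 24)%:E)%E.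
  apply: (@le_trans _ _ (\sum_(j < K) P (far j))%E).
    by rewrite /bad bigcup_mkord; exact: Boole_inequality.
  apply: (@le_trans _ _ (\sum_(j < K)
      (6 * (nverts (e j) ^ 2)%:R / K.+1%:R^-1 ^+ 2 / n.+1%:R)%:E)%E).
    by apply: lee_sum => j _; apply: sampled_density_far; rewrite // invr_gt0.
  by rewrite sumEFin lee_fin -mulr_suml.
pose Q (i j : 'I_N) := G @^-1` splits 0 i j.
have mQ i j : measurable (Q i j) by exact: mS.
have lower : (n * n.-1)%:R * p <= \sum_(i : 'I_N) \sum_(j : 'I_N) fine (P (Q i j)).
  have F0 (i j : 'I_N) : 0 <= fine (P (Q i j)) by rewrite fine_ge0.
  rewrite big_ord_recl /= ler_wpDl ?sumr_ge0//.
  have -> : (n * n.-1)%:R * p = \sum_(i < n) (n.-1%:R * p) :> R.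
    by rewrite sumr_const card_ord -[RHS]mulr_natl mulrA -natrM.
  apply: ler_sum => i _; rewrite big_ord_recl /= ler_wpDl//.
  have -> : n.-1%:R * p = \sum_(j < n | j != i) p :> R.
    rewrite sumr_const -[RHS]mulr_natl; congr (_%:R * _).
    by rewrite (cardC1 i) card_ord.
  rewrite [leRHS](bigD1 i)//= ler_wpDl//; apply: ler_sum => j ji.
  by rewrite /Q prob_splits//= /bump /= eqn_add2l eq_sym.
have upper : \sum_(i : 'I_N) \sum_(j : 'I_N) fine (P (Q i j)) <=
    N%:R ^+ 2 * (p / 24 + fine (P bad)).
  pose Phi w : R := \sum_(i : 'I_N) \sum_(j : 'I_N) \1_(Q i j) w.
  have mind (A : set T) : measurable A -> measurable_fun setT (fun w => (\1_A w)%:E : \bar R).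
    by move=> mA; apply/measurable_EFinP; exact: measurable_indic.
  have PhiE : (\int[P]_w (Phi w)%:E =
      (\sum_(i : 'I_N) \sum_(j : 'I_N) fine (P (Q i j)))%:E)%E.
    under eq_integral do rewrite /Phi -sumEFin.
    rewrite ge0_integral_sum//; first last.
    - by move=> i w _; rewrite lee_fin sumr_ge0.
    - move=> i; under eq_fun do rewrite -sumEFin.
      by apply: emeasurable_sum => j; exact: mind.
    rewrite -sumEFin; apply: eq_bigr => i _.
    under eq_integral do rewrite -sumEFin.
    rewrite ge0_integral_sum//; last by move=> j; exact: mind.
    rewrite -sumEFin; apply: eq_bigr => j _.
    by rewrite integral_indic// setIT fineK// Pfin.
  have Phi_le w : Phi w <= N%:R ^+ 2 * (p / 24 + \1_bad w).
    pose C := [set i : 'I_N | `[< component (G w) 0 i >]]%SET.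
    have -> : Phi w = #|C|%:R * #|(~: C)%SET|%:R.
      rewrite -!sum1_card !natr_sum big_distrl /= [RHS]big_mkcond /=.
      apply: eq_bigr => i _; case: ifPn => iC.
        rewrite mul1r [RHS]big_mkcond /=; apply: eq_bigr => j _.
        rewrite indicE finset.in_setC; case: ifPn => jC.
          rewrite mem_set//; split.
            by move: iC; rewrite finset.inE => /asboolP.
          by move=> cj; case/negP: jC; rewrite finset.inE; exact/asboolP.
        rewrite memNset// => -[_]; apply.
        by move: jC; rewrite negbK finset.inE => /asboolP.
      rewrite big1// => j _; rewrite indicE memNset// => -[ci _].
      by case/negP: iC; rewrite finset.inE; exact/asboolP.
    have CN : #|C|%:R + #|(~: C)%SET|%:R = N%:R :> R.
      by rewrite -natrD cardsC card_ord.
    have [wbad|wgood] := pselect (bad w).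
      rewrite indicE mem_set// (@le_trans _ _ (N%:R ^+ 2))//.
        rewrite expr2 ler_pM// -CN ?lerDl ?lerDr//.
      by rewrite ler_peMr ?sqr_ge0//= lerDr ltW.
    rewrite indicE memNset// addr0.
    have := KP (initial_graph (G w) n) (leqW nK) _ C
      (component_closed_initial (g := G w) (n := n)).
    have good j : (j < K)%N ->
        `|hom_density R (e j) (initial_graph (G w) n) - Gam (e j)| < K.+1%:R^-1.
      by move=> jK; rewrite ltNge; apply/negP => H; apply: wgood; exists j.
    move=> /(_ good) /=.
    have -> : 1 - #|C|%:R / n.+1%:R = #|(~: C)%SET|%:R / N%:R :> R.
      by rewrite -{1}(divff (lt0r_neq0 N0)) -mulrBl -CN addrC addKr.
    rewrite mulf_div -expr2 ltr_pdivrMr ?exprn_gt0// => /ltW.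
    by rewrite [leRHS]mulrC.
  rewrite -lee_fin -PhiE.
  apply: (@le_trans _ _ (\int[P]_w (N%:R ^+ 2 * (p / 24 + \1_bad w))%:E)%E).
    apply: ge0_le_integral => //.
    - by move=> w _; rewrite lee_fin sumr_ge0// => i _; rewrite sumr_ge0.
    - apply/measurable_EFinP; apply: measurable_sum => i.
      by apply: measurable_sum => j; exact: measurable_indic.
    - apply/measurable_EFinP; apply: measurable_funM => //.
      by apply: measurable_funD => //; exact: measurable_indic.
    - by move=> w _; rewrite lee_fin.
  under eq_integral do rewrite EFinM EFinD.
  rewrite ge0_integralZl//; first last.
  - by move=> w _; rewrite -EFinD lee_fin addr_ge0// ltW.
  - by apply: emeasurable_funD => //; exact: mind.
  rewrite ge0_integralD//; first last.
  - exact: mind.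
  - by move=> w _; rewrite lee_fin ltW.
  rewrite integral_cst//= probability_setT mule1 integral_indic// setIT.
  by rewrite [leRHS]EFinM [in leRHS]EFinD fineK// Pfin.
have PbadR : fine (P bad) <= p / 24 by rewrite -lee_fin fineK ?Pfin// .
have := le_trans lower upper; apply/negP; rewrite -ltNge.
apply: (@le_lt_trans _ _ (N%:R ^+ 2 * (p / 12))).
  by rewrite ler_wpM2l ?sqr_ge0//; lra.
have NN : (N ^ 2 <= 6 * (n * n.-1))%N by rewrite /N; nia.
have : N%:R ^+ 2 <= 6 * (n * n.-1)%:R :> R.
  by rewrite -natrX -natrM ler_nat.
have : 0 < N%:R ^+ 2 :> R by rewrite exprn_gt0.
set X := N%:R ^+ 2; set Y := (n * n.-1)%:R; nra.
Qed.

End splitting_events.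

Definition connected_graph : set igraph :=
  [set g | forall u v, component g u v].

Lemma measurable_connected_graph : measurable connected_graph.
Proof.
apply: measurable_forall => u; apply: measurable_forall => v.
exact: measurable_component.
Qed.

Definition no_edge : set igraph := [set g : igraph | forall i j, g i j = false].

Lemma measurable_no_edge : measurable no_edge.
Proof.
apply: measurable_forall => i; apply: measurable_forall => j.
exact: measurable_edge.
Qed.

(** If a is adjacent to b and no triple is split, then the component of a,
    which contains b, contains every vertex. *)
Lemma connected_or_split (g : igraph) : connected_graph g \/ no_edge g \/
  exists v i j, [/\ v != i, v != j, i != j & splits v i j g].
Proof.
have [Hs|Hs] := pselect (exists v i j, [/\ v != i, v != j, i != j & splits v i j g]).
  by right; right.
have [[a [b ab]]|nE] := pselect (exists a b, g a b); last first.
  right; left=> i j; apply/negbTE/negP => gij; apply: nE; by exists i, j.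
left; have aC x : component g a x.
  have [->|xa] := eqVneq x a; first exact: component_refl.
  have [->|xb] := eqVneq x b; first exact: component_edge.
  apply: contrapT => nax; apply: Hs; exists a, b, x; split; last first.
  - by split => //; exact: component_edge.
  - by rewrite eq_sym.
  - by rewrite eq_sym.
  - by apply/eqP => e; move: ab; rewrite e iadj_irr.
by move=> u v; apply: component_trans (aC v); exact: component_sym.
Qed.

Section almost_surely_connected.
Context (R : realType) (Gam : graph_limit R) d (T : measurableType d)
  (P : probability T R) (G : {RV P >-> igraph}).
Hypothesis GP : has_densities Gam G.
Hypothesis Gam_conn : connected_limit Gam.

(** On edgeless graphs the sampled densities vanish, which is far from the
    positive density Gam F. *)
Lemma prob_no_edge : P (G @^-1` no_edge) = 0%E.
Proof.
have [F [F0 GF]] := connected_limit_nontrivial Gam_conn.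
have mE : measurable (G @^-1` no_edge).
  exact: measurable_RV_preimage measurable_no_edge.
pose c : R := 6 * (nverts F ^ 2)%:R / Gam F ^+ 2.
have Pc n : (P (G @^-1` no_edge) <= (c / n.+1%:R)%:E)%E.
  apply: le_trans (sampled_density_far GP F n GF).
  apply: le_measure; rewrite ?inE//; first exact: measurable_sampled_density_far.
  move=> w /= nE; rewrite (_ : sampled_density G F n w = 0).
    by rewrite sub0r normrN ler_norm.
  rewrite /sampled_density /hom_density (_ : #|_| = 0%N) ?mul0r//.
  apply: eq_card0 => phi; rewrite !inE; apply/negbTE/negP => /is_homP hphi.
  move/card_gt0P: F0 => [[x y]]; rewrite inE /= => /andP[_ /hphi].
  by rewrite /= nE.
apply/eqP; rewrite eq_le measure_ge0 andbT.
rewrite -[P _]fineK ?fin_num_measure// lee_fin leNgt; apply/negP => q0.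
set q := fine _ in q0.
have : q <= c / (Num.truncn (c / q)).+2%:R.
  by rewrite -lee_fin fineK ?fin_num_measure.
rewrite ler_pdivlMr ?ltr0n// mulrC -ler_pdivlMr//; apply/negP; rewrite -ltNge.
by apply: (lt_trans (truncnS_gt _)); rewrite ltr_nat.
Qed.

Lemma prob_connected_graph : P (G @^-1` connected_graph) = 1%E.
Proof.
have mC := measurable_RV_preimage G measurable_connected_graph.
suff H : P (~` (G @^-1` connected_graph)) = 0%E.
  have := probability_setC P (measurableC mC).
  by rewrite setCK H sube0.
pose A n : set igraph := if unpickle n is Some (v, i, j)
  then if [&& v != i, v != j & i != j] then splits v i j else set0 else set0.
have mA n : measurable (A n).
  rewrite /A; case: unpickle => // -[[v i] j]; case: ifP => // _.
  exact: measurable_splits.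
have PA n : P (G @^-1` A n) = 0%E.
  rewrite /A; case: unpickle => [[[v i] j]|]; last by rewrite preimage_set0 measure0.
  case: ifP => [/and3P[vi vj ij]|_]; last by rewrite preimage_set0 measure0.
  by rewrite (prob_splits GP)// (prob_splits0 GP).
apply/negligibleP; first exact: measurableC.
apply: (@negligibleS _ _ _ _ ((G @^-1` no_edge) `|` \bigcup_n (G @^-1` A n))).
  move=> w /= nc; case: (connected_or_split (G w)) => [//|[nE|]]; first by left.
  move=> [v [i [j [vi vj ij sp]]]]; right; exists (pickle (v, i, j)) => //=.
  by rewrite /A pickleK vi vj ij.
apply: negligibleU.
  apply/negligibleP; last exact: prob_no_edge.
  exact: measurable_RV_preimage measurable_no_edge.
apply: negligible_bigcup => n; apply/negligibleP; last exact: PA.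
exact: measurable_RV_preimage.
Qed.

End almost_surely_connected.

(** * Independent marks *)

Section scaling.
Context (R : realType).
Local Notation lambda := (@lebesgue_measure R).

Lemma lebesgue_measure_affine (a b : R) (E : set R) : 0 < a -> measurable E ->
  lambda [set x | E ((x - b) / a)] = (a%:E * lambda E)%E.
Proof.
move=> a0 mE.
have mf : measurable_fun [set: measurableTypeR R] (fun x : R => (x - b) / a : measurableTypeR R).
  by apply: measurable_funM => //; exact: measurable_funB.
have ai : 0 <= a^-1 by rewrite invr_ge0 ltW.
pose mu := mscale (NngNum ai) (image_measure lambda (to_mfun mf)).
have muE A : mu A = ((a^-1)%:E * lambda [set x : R | A ((x - b) / a)%R])%E by [].
have -> : lambda E = mu E.
  apply: lebesgue_measure_unique mE => _ [[u v] _ <-].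
  rewrite -[RHS]/((a^-1)%:E * lambda [set x : R | `]u, v]%classic ((x - b) / a)%R])%E /=.
  rewrite (_ : [set x : R | (x - b) / a \in `]u, v]] = `]a * u + b, a * v + b]%classic); last first.
    apply/seteqP; split=> x /=; rewrite !in_itv /= ltr_pdivlMr// ler_pdivrMr//;
      rewrite ltrBrDr lerBlDr (mulrC u) (mulrC v)//.
  rewrite !lebesgue_measure_itv /= !lte_fin ltrD2r ltr_pM2l//.
  case: ifPn => _; last by rewrite mule0.
  by rewrite -!EFinB -EFinM opprD addrACA subrr addr0 -mulrBr mulKf// gt_eqF.
by rewrite muE muleA -EFinM divff ?gt_eqF// mul1e.
Qed.

End scaling.

(** The digits of a uniform point of [0, 1[ in the expansion that cuts an
    interval in the proportions alpha : 1 - alpha at each step. *)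
Section marks.
Context (R : realType) (alpha : R).
Hypothesis alpha01 : 0 <= alpha <= 1.
Local Notation lambda := (@lebesgue_measure R).

Definition unit_measure : {measure set (measurableTypeR R) -> \bar R} :=
  mrestr lambda (measurable_itv `[(0 : R), 1[).

Lemma unit_measureE A : unit_measure A = lambda (A `&` `[0, 1[).
Proof. by []. Qed.

Lemma unit_measure_setT : unit_measure setT = 1%E.
Proof. by rewrite unit_measureE setTI lebesgue_measure_itv /= lte01 oppr0 adde0. Qed.

Definition digit_shift (x : R) : R :=
  if x < alpha then x / alpha else (x - alpha) / (1 - alpha).

Definition mark (n : nat) : set (measurableTypeR R) :=
  [set x : R | iter n digit_shift x < alpha].

Lemma measurable_digit_shift :
  measurable_fun [set: measurableTypeR R] (digit_shift : measurableTypeR R -> measurableTypeR R).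
Proof.
apply: measurable_fun_ifT => /=.
- exact: measurable_fun_ltr.
- exact: measurable_funM.
- by apply: measurable_funM => //; exact: measurable_funB.
Qed.

Lemma measurable_mark n : measurable (mark n).
Proof.
have mi : measurable_fun [set: measurableTypeR R]
    (iter n digit_shift : measurableTypeR R -> measurableTypeR R).
  elim: n => [|n IH]; first exact: measurable_id.
  exact: measurableT_comp measurable_digit_shift IH.
rewrite (_ : mark n = iter n digit_shift @^-1` `]-oo, alpha[); last first.
  by apply/seteqP; split=> x /=; rewrite in_itv.
by rewrite -[X in measurable X]setTI; exact: mi.
Qed.

(** When 0 < alpha < 1, both branches of the digit shift are affine bijections
    onto [0, 1[, so the first mark is independent of the shifted point, which
    is again uniform; when alpha is 0 or 1, only one branch meets [0, 1[. *)
Lemma lambda_first_digit (E : set R) : measurable E -> E `<=` `[0, 1[ ->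
  lambda ([set x | x < alpha /\ E (digit_shift x)] `&` `[0, 1[) =
    (alpha%:E * lambda E)%E /\
  lambda ([set x | ~ (x < alpha) /\ E (digit_shift x)] `&` `[0, 1[) =
    ((1 - alpha)%:E * lambda E)%E.
Proof.
move=> mE E01; have /andP[a0 a1] := alpha01; split.
  move: a0; rewrite le_eqVlt => /orP[/eqP <-|a0].
    rewrite mul0e (_ : _ `&` _ = set0) ?measure0//.
    apply/seteqP; split=> x //= [[x0 _]]; rewrite in_itv /= => /andP[+ _].
    by rewrite leNgt x0.
  rewrite -(@lebesgue_measure_affine _ _ 0)//; congr (lambda _).
  apply/seteqP; split=> x /=; rewrite subr0.
    by move=> [[xa]]; rewrite /digit_shift xa.
  move=> Ex; have := E01 _ Ex; rewrite /= in_itv /= => /andP[x0 x1].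
  have xa : x < alpha by move: x1; rewrite ltr_pdivrMr// mul1r.
  rewrite /digit_shift xa in_itv /= (lt_le_trans xa a1); split => //.
  by move: x0; rewrite ler_pdivlMr// mul0r => ->.
move: a1; rewrite le_eqVlt => /orP[/eqP a1|a1].
  rewrite a1 subrr mul0e (_ : _ `&` _ = set0) ?measure0//.
  by apply/seteqP; split=> x //= [[x0 _]]; rewrite in_itv /= => /andP[_].
have b0 : 0 < 1 - alpha by rewrite subr_gt0.
rewrite -(@lebesgue_measure_affine _ _ alpha)//; congr (lambda _).
apply/seteqP; split=> x /=.
  by move=> [[xa]]; rewrite /digit_shift ifF//; apply/negbTE/negP.
move=> Ex; have := E01 _ Ex; rewrite /= in_itv /= => /andP[x0 x1].
have xa : alpha <= x by move: x0; rewrite ler_pdivlMr// mul0r subr_ge0.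
have nxa : ~ x < alpha by apply/negP; rewrite -leNgt.
rewrite /digit_shift ifF ?in_itv /=; last exact/negbTE/negP.
split => //; rewrite (le_trans a0 xa)/=.
by move: x1; rewrite ltr_pdivrMr// mul1r ltrD2r.
Qed.

Lemma digit_shift_unit x : `[0, 1[%classic x -> `[0, 1[%classic (digit_shift x).
Proof.
rewrite /= !in_itv /= /digit_shift => /andP[x0 x1]; case: ltP => xa.
  have a0 : 0 < alpha by exact: le_lt_trans xa.
  by apply/andP; split; [exact: divr_ge0 x0 (ltW a0)|rewrite ltr_pdivrMr// mul1r].
have b0 : 0 < 1 - alpha by rewrite subr_gt0 (le_lt_trans xa).
apply/andP; split; last by rewrite ltr_pdivrMr// mul1r ltrD2r.
by apply: divr_ge0 (ltW b0); rewrite subr_ge0.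
Qed.

(** Here p j b tells whether b is an allowed value of the j-th mark, so that one
    induction on the digits serves both the presence of given marks and the
    absence of all marks in a range. *)
Lemma mark_pattern n (p : nat -> bool -> bool) :
  measurable [set x : measurableTypeR R | forall j, (j < n)%N -> p j (iter j digit_shift x < alpha)] /\
  unit_measure [set x | forall j, (j < n)%N -> p j (iter j digit_shift x < alpha)] =
  (\prod_(j < n) (alpha * (p j true)%:R + (1 - alpha) * (p j false)%:R))%:E.
Proof.
have mg m (q : nat -> bool -> bool) : measurable
    [set x : measurableTypeR R | forall j, (j < m)%N -> q j (iter j digit_shift x < alpha)].
  apply: measurable_forall => j; apply: measurable_guard.
  rewrite -[X in measurable X]/[set x : measurableTypeR R | q j (iter j digit_shift x < alpha)].
  have := measurable_mark j; rewrite /mark => mj.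
  case qt : (q j true); case qf : (q j false).
  - rewrite (_ : [set x | _] = setT)//; apply/seteqP; split=> // x _ /=.
    by case: (_ < _).
  - rewrite (_ : [set x | _] = mark j)//; apply/seteqP; split=> x /=; rewrite /mark /=;
      by case: (_ < _); rewrite ?qt ?qf.
  - rewrite (_ : [set x | _] = ~` mark j); first exact: measurableC.
    apply/seteqP; split=> x /=; rewrite /mark /=;
      by case: (_ < _); rewrite ?qt ?qf.
  - rewrite (_ : [set x | _] = set0)//; apply/seteqP; split=> x //=.
    by case: (_ < _); rewrite ?qt ?qf.
split; first exact: mg.
elim: n p => [|n IH] p.
  rewrite big_ord0 -unit_measure_setT; congr (unit_measure _).
  by apply/seteqP; split.
pose E : set R := [set x : measurableTypeR R | forall j, (j < n)%N ->
  p j.+1 (iter j digit_shift x < alpha)] `&` `[0, 1[.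
have mE : measurable (E : set (measurableTypeR R)).
  by apply: measurableI => //; exact: (mg n (fun j => p j.+1)).
have lamE : lambda E = (\prod_(j < n) (alpha * (p j.+1 true)%:R +
    (1 - alpha) * (p j.+1 false)%:R))%:E by rewrite -(IH (fun j => p j.+1)).
pose A (b : bool) : set R :=
  [set x : R | (x < alpha) = b /\ E (digit_shift x)] `&` `[0, 1[.
have A1 : lambda (A true) = (alpha%:E * lambda E)%E.
  exact: (lambda_first_digit mE (@subIsetr _ _ _)).1.
have A0E : A false = [set x : R | ~ (x < alpha) /\ E (digit_shift x)] `&` `[0, 1[.
  by apply/seteqP; split=> x [[xa Ex] x01]; split => //; split => //;
    [rewrite xa|apply/negbTE/negP].
have A0 : lambda (A false) = ((1 - alpha)%:E * lambda E)%E.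
  by rewrite A0E; exact: (lambda_first_digit mE (@subIsetr _ _ _)).2.
have mA b : measurable (A b : set (measurableTypeR R)).
  have mEs : measurable (digit_shift @^-1` E : set (measurableTypeR R)).
    by rewrite -[X in measurable X]setTI; exact: measurable_digit_shift.
  have m0 : measurable [set x : measurableTypeR R | (x < alpha) = true].
    exact: (measurable_mark 0).
  have m1 : measurable [set x : measurableTypeR R | (x < alpha) = false].
    rewrite (_ : [set x : R | _] = ~` [set x : measurableTypeR R | (x < alpha) = true]).
      exact: measurableC.
    by apply/seteqP; split=> x /=; [move=> ->|move=> ?; exact/negbTE/negP].
  by apply: measurableI => //; apply: measurableI => //; case: b.
pose A' b : set R := if p 0%N b then A b else set0.
have mA' b : measurable (A' b : set (measurableTypeR R)) by rewrite /A'; case: ifP.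
have A'E b : lambda (A' b) = ((p 0%N b)%:R%:E * lambda (A b))%E.
  by rewrite /A'; case: ifP; rewrite ?mul1e// mul0e measure0.
rewrite unit_measureE (_ : _ `&` _ = A' true `|` A' false); last first.
  apply/seteqP; split=> x.
    move=> [H x01]; have Tx01 := digit_shift_unit x01.
    have ETx : E (digit_shift x).
      by split=> // j jn; rewrite -iterSr; exact: (H j.+1).
    have := H 0%N isT; rewrite /A' /=; case xa : (x < alpha) => p0; [left|right];
      by rewrite p0.
  rewrite /A'; move=> [|]; case: ifP => // p0 [[xa [HE _]] x01]; split => //;
    by move=> [|j] /= jn; rewrite ?xa// -iterS iterSr; exact: HE.
have -> : lambda (A' true `|` A' false) = (lambda (A' true) + lambda (A' false))%E.
  apply: measureU => //; rewrite -subset0 /A' => x [].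
  case: ifP => // _ [[xt _] _]; case: ifP => // _ [[xf _] _].
  by rewrite xt in xf.
rewrite !A'E A1 A0 lamE big_ord_recl /= -!EFinM -EFinD; congr (_%:E).
by rewrite !mulrA -mulrDl [alpha * _]mulrC [(1 - alpha) * _]mulrC.
Qed.

Lemma mark_prob (V : seq nat) : uniq V ->
  measurable [set x | forall j, j \in V -> mark j x] /\
  unit_measure [set x | forall j, j \in V -> mark j x] = (alpha ^+ size V)%:E.
Proof.
move=> uV; pose n := (\max_(j <- V) j).+1.
have Vn j : j \in V -> (j < n)%N by move=> jV; rewrite ltnS; exact: leq_bigmax_seq.
have -> : [set x | forall j, j \in V -> mark j x] =
    [set x | forall j, (j < n)%N -> (j \in V) ==> (iter j digit_shift x < alpha)].
  apply/seteqP; split=> x /= H j; first by move=> _; apply/implyP; exact: H.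
  by move=> jV; have := H j (Vn _ jV); rewrite jV.
have [mP ->] := mark_pattern n (fun j b => (j \in V) ==> b); split => //.
congr (_%:E); transitivity (\prod_(j < n | nat_of_ord j \in V) alpha).
  rewrite [RHS]big_mkcond /=; apply: eq_bigr => j _.
  by case: ifP => _ /=; rewrite ?mulr1 ?mulr0 ?addr0// addrC subrK.
rewrite prodr_const; congr (_ ^+ _).
rewrite -sum1_card -(big_mkord (mem V) (fun=> 1%N)) sum1_count -size_filter.
apply/perm_size/uniq_perm => //; first by rewrite filter_uniq// iota_uniq.
move=> j; rewrite mem_filter mem_iota /= add0n subn0.
by case: (boolP (j \in V)) => //= /Vn ->.
Qed.

(** By independence, the k marks that follow m are all absent with probability
    (1 - alpha)^k. *)
Lemma infinitely_many_marks : 0 < alpha ->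
  measurable [set x | forall m, exists j, (m <= j)%N /\ mark j x] /\
  unit_measure (~` [set x | forall m, exists j, (m <= j)%N /\ mark j x]) = 0%E.
Proof.
move=> a0; have /andP[_ a1] := alpha01.
pose D m := [set x : measurableTypeR R | forall j, (m <= j)%N -> ~ mark j x].
have mD m : measurable (D m).
  apply: measurable_forall => j; apply: measurable_guard.
  exact: measurableC (measurable_mark j).
have DE : ~` [set x | forall m, exists j, (m <= j)%N /\ mark j x] = \bigcup_m D m.
  apply/seteqP; split=> x /=.
    move=> /existsNP[m nm]; exists m => //= j mj xj; apply: nm; by exists j.
  by move=> [m _ H] /(_ m)[j [mj xj]]; exact: H xj.
have mU : measurable (\bigcup_m D m) by exact: bigcupT_measurable.
split; first by rewrite -[X in measurable X]setCK DE; exact: measurableC.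
rewrite DE; apply/negligibleP => //; apply: negligible_bigcup => m.
apply/negligibleP => //.
have Dk k : (unit_measure (D m) <= ((1 - alpha) ^+ k)%:E)%E.
  have [mP PE] := mark_pattern (m + k) (fun j b => (m <= j)%N ==> ~~ b).
  have -> : (1 - alpha) ^+ k = \prod_(j < m + k) (alpha * ((m <= j)%N ==> ~~ true)%:R +
      (1 - alpha) * ((m <= j)%N ==> ~~ false)%:R).
    rewrite big_split_ord /= big1 ?mul1r; last first.
      by move=> j _; rewrite leqNgt ltn_ord /= !mulr1 addrC subrK.
    rewrite (eq_bigr (fun=> 1 - alpha)) ?prodr_const ?card_ord//.
    by move=> j _; rewrite leq_addr /= mulr0 add0r mulr1.
  rewrite -PE; apply: le_measure; rewrite ?inE//.
  by move=> x Dx j _; apply/implyP => mj; apply/negP; exact: Dx.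
have fin : unit_measure (D m) \is a fin_num.
  by rewrite ge0_fin_numE//; apply: (le_lt_trans (Dk 0%N)); rewrite ltry.
suff : fine (unit_measure (D m)) <= 0.
  move=> D0; apply/eqP; rewrite eq_le; apply/andP; split; last exact: measure_ge0.
  by have := D0; rewrite -lee_fin fineK.
have : (1 - alpha) ^+ k @[k --> \oo] --> 0.
  by apply: cvg_expr; rewrite ger0_norm ?subr_ge0// ltrBlDr ltrDl.
move=> cvg0; rewrite -(cvg_lim _ cvg0)//; apply: limr_ge.
  by apply/cvg_ex; exists 0.
by near=> k; rewrite -lee_fin fineK.
Unshelve. all: by end_near. Qed.

End marks.

(** * Enumerating an infinite set of vertices *)

Lemma infinite_unbounded (C : set nat) :
  infinite_set C <-> forall m, exists j, (m <= j)%N /\ C j.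
Proof.
split=> [infC m|unb].
  apply: contrapT => nm; apply: infC; apply: (@sub_finite_set _ _ `I_m) => // j Cj /=.
  by rewrite ltnNge; apply/negP => mj; apply: nm; exists j.
move=> /finite_seqP[s sE]; have [j [sj]] := unb (\max_(i <- s) i).+1.
by rewrite sE /= => js; move: sj; rewrite ltnNge leq_bigmax_seq.
Qed.

Definition count_below (C : set nat) (c : nat) : nat := \sum_(x < c) `[< C x >].

Lemma count_belowS C c : count_below C c.+1 = (count_below C c + `[< C c >])%N.
Proof. by rewrite /count_below big_ord_recr. Qed.

(** The cardinality condition in the definition of the enumeration says that
    the number of smaller elements is i; as a number it is amenable to
    induction and to measurability proofs. *)
Lemma count_below_card C c : C `&` `I_c #= `I_(count_below C c).
Proof.
elim: c => [|c IH].
  by rewrite II0 setI0 /count_below big_ord0 II0.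
rewrite count_belowS; case: asboolP => Cc.
  rewrite addn1; apply/eq_cardSP; exists c; first by split => /=.
  rewrite (_ : _ `\ c = C `&` `I_c)//; apply/seteqP; split=> x /=.
    by move=> [[Cx xc] ne]; split=> //; rewrite ltn_neqAle -ltnS xc andbT; exact/eqP.
  by move=> [Cx xc]; split; [split=> //; exact: ltnW|move=> e; rewrite e ltnn in xc].
rewrite addn0 (_ : C `&` `I_c.+1 = C `&` `I_c)//; apply/seteqP; split=> x /=.
  move=> [Cx xc]; split=> //; rewrite ltn_neqAle -ltnS xc andbT; apply/eqP => e.
  by apply: Cc; rewrite -e.
by move=> [Cx xc]; split=> //; exact: ltnW.
Qed.

Lemma count_below_mono C c c' : (c <= c')%N -> (count_below C c <= count_below C c')%N.
Proof.
move=> cc'; rewrite -(subnKC cc'); elim: (c' - c)%N => [|k IH]; first by rewrite addn0.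
by rewrite addnS count_belowS (leq_trans IH)// leq_addr.
Qed.

Lemma count_below_lt (C : set nat) c c' : C c -> (c < c')%N ->
  (count_below C c < count_below C c')%N.
Proof.
move=> Cc cc'; rewrite (leq_trans _ (count_below_mono C cc'))//.
by rewrite count_belowS (asboolT Cc) addn1.
Qed.

Lemma nth_eltE (C : set nat) c : C c -> nth_elt C (count_below C c) = c.
Proof.
move=> Cc; rewrite /nth_elt; case: xgetP => [x _ [Cx xI]|/(_ c)]; last first.
  by case; split=> //; exact: count_below_card.
have e : count_below C x = count_below C c.
  apply/card_eq_II; apply: card_eq_trans xI; rewrite card_eq_sym.
  exact: count_below_card.
apply/eqP; rewrite eqn_leq; apply/andP; split; rewrite leqNgt; apply/negP => lt.
  by have := count_below_lt Cc lt; rewrite e ltnn.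
by have := count_below_lt Cx lt; rewrite e ltnn.
Qed.

Lemma count_below_onto (C : set nat) i : infinite_set C ->
  exists c, C c /\ count_below C c = i.
Proof.
move=> /infinite_unbounded unb.
have next c : exists c', C c' /\ count_below C c' = count_below C c.
  have ex : exists j, (c <= j)%N && `[< C j >].
    by have [j [cj Cj]] := unb c; exists j; rewrite cj; exact/asboolP.
  have [c' /andP[cc' /asboolP Cc'] minc] := ex_minnP ex.
  exists c'; split => //; rewrite -(subnKC cc').
  have : forall k, (k <= c' - c)%N -> count_below C (c + k) = count_below C c.
    elim=> [|k IH] kc; first by rewrite addn0.
    rewrite addnS count_belowS IH ?(ltnW kc)//.
    case: asboolP => [Cck|]; last by rewrite addn0.
    have := minc (c + k)%N; rewrite leq_addr (asboolT Cck) => /(_ isT); lia.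
  exact.
elim: i => [|i [c [Cc ci]]].
  by have [c' [Cc' e]] := next 0%N; exists c'; rewrite e /count_below big_ord0.
have [c' [Cc' e]] := next c.+1; exists c'; split=> //.
by rewrite e count_belowS ci (asboolT Cc) addn1.
Qed.

Section nth_elt_infinite.
Variables (C : set nat) (infC : infinite_set C).

Lemma nth_elt_in i : C (nth_elt C i).
Proof. by have [c [Cc <-]] := count_below_onto i infC; rewrite nth_eltE. Qed.

Lemma nth_elt_count i : count_below C (nth_elt C i) = i.
Proof. by have [c [Cc <-]] := count_below_onto i infC; rewrite nth_eltE. Qed.

Lemma nth_elt_inj : injective (nth_elt C).
Proof. exact: can_inj nth_elt_count. Qed.

End nth_elt_infinite.

Lemma nth_elt0 (C : set nat) : C 0%N -> nth_elt C 0 = 0%N.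
Proof. by move=> C0; have := nth_eltE C0; rewrite /count_below big_ord0. Qed.

(** * Measurability of the relabelled component *)

Definition infinite_component : set igraph := [set g | infinite_set (component g 0)].

Lemma measurable_infinite_component : measurable infinite_component.
Proof.
rewrite (_ : infinite_component =
    [set g | forall m : nat, exists j : nat, [set g' | (m <= j)%N /\ component g' 0 j] g]).
  apply: measurable_forall => m; apply: measurable_exists => j.
  exact: measurable_constI (measurable_component 0 j).
by apply/seteqP; split=> g /infinite_unbounded.
Qed.

Definition singleton_component : set igraph := [set g | component g 0 = [set 0%N]].

Lemma measurable_singleton_component : measurable singleton_component.
Proof.
rewrite (_ : singleton_component =
    [set g | forall u : nat, [set g' | u <> 0%N -> (~` [set h | component h 0 u]) g'] g]).
  apply: measurable_forall => u; apply: measurable_guard.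
  exact: measurableC (measurable_component _ _).
apply/seteqP; split=> g /= H; first by move=> u u0; rewrite H.
apply/seteqP; split=> u; last by move=> ->; exact: component_refl.
by move=> gu; apply: contrapT => /H.
Qed.

Lemma measurable_count_below c i :
  measurable [set g | count_below (component g 0) c = i].
Proof.
elim: c i => [|c IH] i.
  rewrite (_ : [set _ | _] = [set g : igraph | 0%N = i /\ [set: igraph] g]).
    exact: measurable_constI measurableT.
  by apply/seteqP; split=> g /=; rewrite /count_below big_ord0 => // -[].
rewrite (_ : [set _ | _] =
  ([set g | component g 0 c] `&` [set g | exists k : nat,
     [set g' | i = k.+1 /\ count_below (component g' 0) c = k] g]) `|`
  (~` [set g | component g 0 c] `&` [set g | count_below (component g 0) c = i])).
  apply: measurableU; apply: measurableI => //.
  - exact: measurable_component.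
  - by apply: measurable_exists => k; apply: measurable_constI; exact: IH.
  - exact: measurableC (measurable_component _ _).
apply/seteqP; split=> g /=; rewrite count_belowS.
  case: asboolP => gc e; [left|right]; split=> //; last by rewrite addn0 in e.
  by exists (count_below (component g 0) c); rewrite -e addn1.
move=> [[gc [k [-> <-]]]|[gc <-]]; first by rewrite (asboolT gc) addn1.
by rewrite (asboolF gc) addn0.
Qed.

Lemma relabelled_componentE g i j : relabelled_component g i j <->
  infinite_component g /\ exists a b : nat,
    [/\ component g 0 a /\ count_below (component g 0) a = i,
        component g 0 b /\ count_below (component g 0) b = j & g a b].
Proof.
rewrite /relabelled_component; case: asboolP => infC; split => //.
- move=> gij; split=> //.
  exists (nth_elt (component g 0) i), (nth_elt (component g 0) j).
  by split => //; split; rewrite ?nth_elt_count//; exact: nth_elt_in.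
- by move=> [_ [a [b [[ga <-] [gb <-] gab]]]] /=; rewrite !nth_eltE.
- by move=> [].
Qed.

Lemma measurable_relabelled_component : measurable_fun setT relabelled_component.
Proof.
apply: measurable_fun_igraph => i j.
have mc a k : measurable [set g | component g 0 a /\ count_below (component g 0) a = k].
  by apply: measurableI; [exact: measurable_component|exact: measurable_count_below].
rewrite (_ : [set g | _] = infinite_component `&` [set g | exists a b : nat,
    ([set g' | component g' 0 a /\ count_below (component g' 0) a = i] `&`
     ([set g' | component g' 0 b /\ count_below (component g' 0) b = j] `&`
      [set g' : igraph | g' a b = true])) g]); last first.
  apply/seteqP; split=> g /=.
    move=> /relabelled_componentE[infC [a [b [ga gb gab]]]]; split=> //.
    by exists a, b.
  move=> [infC [a [b [ga [gb gab]]]]]; apply/relabelled_componentE; split=> //.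
  by exists a, b.
apply: measurableI; first exact: measurable_infinite_component.
apply: measurable_exists => a; apply: measurable_exists => b.
apply: measurableI; first exact: mc.
by apply: measurableI; [exact: mc|exact: measurable_edge].
Qed.

(** * The component of the first vertex as a graph on all vertices *)

Lemma igraph_eq (g h : igraph) : (forall a b, g a b = h a b) -> g = h.
Proof.
case: g h => r rs ri [r' rs' ri'] /= E.
have rr : r = r' by apply/funext => a; apply/funext => b; exact: E.
by case: r' / rr rs' ri' E => rs' ri' _; congr IGraph; exact: Prop_irrelevance.
Qed.

(** Keeping the labels, unlike the relabelled component, this graph records
    the edges of the component in a way that is visible to finite edge
    lists. *)
Section component_graph.
Variable g : igraph.

Definition component_adj : rel nat := fun a b => g a b && `[< component g 0 a >].

Lemma component_adj_sym : symmetric component_adj.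
Proof.
move=> a b; rewrite /component_adj iadj_sym; case ab : (g b a) => //=.
have ba : g a b by rewrite iadj_sym.
apply/asbool_equiv_eq; split=> H.
  exact: component_trans H (component_edge ba).
exact: component_trans H (component_edge ab).
Qed.

Lemma component_adj_irr : irreflexive component_adj.
Proof. by move=> a; rewrite /component_adj iadj_irr. Qed.

Definition component_graph : igraph := IGraph component_adj_sym component_adj_irr.

End component_graph.

Lemma component_component_graph g : component (component_graph g) 0 = component g 0.
Proof.
apply/seteqP; split=> u /component_closedP H.
  apply: H; last exact: component_refl.
  by move=> a b /andP[ab _] ga; exact: component_trans ga (component_edge ab).
suff : component g 0 u /\ component (component_graph g) 0 u by case.
apply: (H (fun x => component g 0 x /\ component (component_graph g) 0 x));
  last by split; exact: component_refl.
move=> a b ab [ga ka]; split; first exact: component_trans ga (component_edge ab).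
by apply: (component_trans ka); apply: component_edge; rewrite /= /component_adj ab (asboolT ga).
Qed.

Lemma relabelled_component_graph g :
  relabelled_component (component_graph g) = relabelled_component g.
Proof.
rewrite /relabelled_component component_component_graph.
case: asboolP => // infC; apply: igraph_eq => a b /=.
by rewrite /component_adj (asboolT (nth_elt_in infC a)) andbT.
Qed.

(** Rootedness of an edge list is connectedness together with the first
    vertex, phrased through the graphs that contain it, so that concatenation
    visibly preserves it. *)
Definition rooted (E : seq (nat * nat)) : Prop :=
  forall g, edge_list_event E g -> forall p, p \in E -> component g 0 p.1.

Definition rooted_events : set (set igraph) :=
  [set A | exists2 E, rooted E & A = edge_list_event E].

Lemma rooted_cat E E' : rooted E -> rooted E' -> rooted (E ++ E').
Proof.
move=> rE rE' g; rewrite edge_list_cat => -[gE gE'] p; rewrite mem_cat.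
by move=> /orP[]; [exact: rE|exact: rE'].
Qed.

Lemma rooted_events_setI : setI_closed rooted_events.
Proof.
move=> _ _ [E rE ->] [E' rE' ->]; exists (E ++ E'); first exact: rooted_cat.
by rewrite edge_list_cat.
Qed.

Lemma rooted_events_setT : rooted_events setT.
Proof. by exists [::] => //; apply/seteqP; split. Qed.

Lemma measurable_rooted_events : rooted_events `<=` measurable.
Proof. by move=> _ [E _ ->]; exact: measurable_edge_list. Qed.

Fixpoint path_edges (v : nat) (p : seq nat) : seq (nat * nat) :=
  if p is a :: p' then (v, a) :: path_edges a p' else [::].

Lemma path_edgesP g v p : edge_list_event (path_edges v p) g <-> path g v p.
Proof.
elim: p v => [|a p IH] v /=; split=> //.
  move=> H; rewrite (H (v, a)) ?mem_head//=; apply/IH => q qp.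
  by apply: H; rewrite in_cons qp orbT.
move=> /andP[va /IH H] q; rewrite in_cons => /orP[/eqP -> //|]; exact: H.
Qed.

Lemma path_edges_component (g : igraph) v p : path g v p ->
  forall q, q \in path_edges v p -> component g v q.1.
Proof.
elim: p v => //= a p IH v /andP[va ap] q; rewrite in_cons => /orP[/eqP ->|qp].
  exact: component_refl.
exact: component_trans (component_edge va) (IH _ ap _ qp).
Qed.

(** An edge lies in the component of the first vertex when it can be added to
    the edges of some path from the first vertex, and such edge lists are
    rooted; there are countably many paths. *)
Lemma component_graph_rooted (A : set igraph) : measurable A ->
  <<s rooted_events >> (component_graph @^-1` A).
Proof.
move=> mA; pose D : measurableType _ := g_sigma_algebraType rooted_events.
suff mK : measurable_fun [set: D] (component_graph : D -> igraph).
  by have := mK measurableT A mA; rewrite setTI.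
apply: measurable_fun_igraph => a b.
rewrite (_ : [set g | _] = [set g : D | exists p : seq nat,
    [set g' : D | last 0%N p = a /\ edge_list_event (path_edges 0 p ++ [:: (a, b)]) g'] g]).
  apply: measurable_exists => p; have [e|ne] := eqVneq (last 0%N p) a; last first.
    rewrite [X in measurable X](_ : _ = set0); first exact: measurable0.
    by apply/seteqP; split=> g //= -[e]; rewrite e eqxx in ne.
  apply: measurable_constI; apply: sub_sigma_algebra; eexists; last by [].
  move=> g; rewrite edge_list_cat => -[/path_edgesP gp gab] q.
  rewrite mem_cat => /orP[|]; first exact: path_edges_component.
  by rewrite inE => /eqP -> /=; exists p.
apply/seteqP; split=> g /=.
  move=> /andP[gab /asboolP[p gp pa]]; exists p; split=> //; rewrite edge_list_cat.
  by split; [exact/path_edgesP|move=> q; rewrite inE => /eqP ->].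
move=> [p [pa]]; rewrite edge_list_cat => -[/path_edgesP gp /(_ (a, b))].
rewrite inE eqxx => /(_ isT) /= gab; rewrite /component_adj gab; apply/asboolP.
by exists p.
Qed.

(** * Thinned graphs *)

(** The graph induced by g on the marked vertices, as a graph on all
    vertices; the first vertex always counts as marked. *)
Section thin.
Variables (B : pred nat) (g : igraph).

Definition kept (a : nat) : bool := (a == 0%N) || B a.

Definition thin_adj : rel nat := fun a b => [&& g a b, kept a & kept b].

Lemma thin_adj_sym : symmetric thin_adj.
Proof. by move=> a b; rewrite /thin_adj iadj_sym; congr andb; rewrite andbC. Qed.

Lemma thin_adj_irr : irreflexive thin_adj.
Proof. by move=> a; rewrite /thin_adj iadj_irr. Qed.

Definition thin : igraph := IGraph thin_adj_sym thin_adj_irr.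

Lemma thin_component_kept u : component thin 0 u -> kept u.
Proof.
move=> /component_closedP H; apply: (H (fun x => kept x)) => // a b.
by move=> /and3P[].
Qed.

End thin.

Lemma no_edge_component g : no_edge g -> component g 0 = [set 0%N].
Proof.
move=> nE; apply/seteqP; split=> u; last by move=> ->; exact: component_refl.
by move=> /component_closedP H; apply: (H [set 0%N]) => // a b; rewrite nE.
Qed.

Lemma singleton_not_infinite : ~ infinite_set [set 0%N].
Proof. by apply; exact: finite_set1. Qed.

Lemma no_edge_relabelled g : no_edge g -> relabelled_component g = g.
Proof.
move=> nE; rewrite /relabelled_component no_edge_component// asboolF; last first.
  exact: singleton_not_infinite.
by apply: igraph_eq => a b /=; rewrite nE.
Qed.

Lemma thin_no_edge B g : no_edge g -> thin B g = g.
Proof. by move=> nE; apply: igraph_eq => a b /=; rewrite /thin_adj nE. Qed.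

Section thin_infinite.
Variables (B : pred nat) (g : igraph).
Let b : set nat := [set a | kept B a].
Hypothesis infB : infinite_set b.
Hypothesis conn : connected_graph (igraph_pull (nth_elt b) g).

Let b0 : b 0%N. Proof. by rewrite /b /= /kept eqxx. Qed.

(** Edges of the induced graph, once its labels are translated back, are edges
    of the thinned graph. *)
Lemma thin_component : component (thin B g) 0 = b.
Proof.
apply/seteqP; split=> u; first exact: thin_component_kept.
move=> bu; rewrite -(nth_eltE bu) -(nth_elt0 b0).
have /component_closedP H := conn 0 (count_below b u).
apply: (H (fun i => component (thin B g) (nth_elt b 0) (nth_elt b i)));
  last exact: component_refl.
move=> i j gij ci; apply: component_trans ci _.
apply: component_edge; apply/and3P; split; first exact: gij.
  exact: (nth_elt_in infB).
exact: (nth_elt_in infB).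
Qed.

Lemma thin_relabelled : relabelled_component (thin B g) = igraph_pull (nth_elt b) g.
Proof.
rewrite /relabelled_component thin_component asboolT//.
apply: igraph_eq => i j /=; rewrite /thin_adj.
have ki : kept B (nth_elt b i) by exact: (nth_elt_in infB).
have kj : kept B (nth_elt b j) by exact: (nth_elt_in infB).
by rewrite ki kj !andbT.
Qed.

End thin_infinite.

Lemma thin_edge_list B g E :
  edge_list_event E (thin B g) <->
  (forall p, p \in E -> kept B p.1 /\ kept B p.2) /\ edge_list_event E g.
Proof.
split=> [H|[H1 H2] p pE].
  by split=> p /H /and3P[].
by have [k1 k2] := H1 p pE; rewrite /= /thin_adj k1 k2 (H2 p pE).
Qed.

Lemma rooted_graph_edges E : loopless E -> E != [::] -> (0 < size_edges (rooted_graph E))%N.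
Proof.
case: E => // -[a b] E' nl _.
have [aV bV] := vertex_listP (mem_head (a, b) E').
set W := vertex_list _ in aV bV *.
have ab : a != b by case/andP: nl.
move: (aV) (bV); rewrite -!index_mem => ia ib.
have adjab : @adj (rooted_graph ((a, b) :: E')) (Ordinal ia) (Ordinal ib).
  rewrite /= /edge_list_adj /= !nth_index// mem_head andbT; apply/orP; left.
  by apply/eqP => -[e]; case/eqP: ab; exact: index_inj aV bV e.
have adjba : @adj (rooted_graph ((a, b) :: E')) (Ordinal ib) (Ordinal ia).
  by rewrite adj_sym.
apply/card_gt0P; case: (ltngtP (index a W) (index b W)) => ltab.
- by exists (Ordinal ia, Ordinal ib); rewrite inE /= ltab.
- by exists (Ordinal ib, Ordinal ia); rewrite inE /= ltab.
- by case/eqP: ab; exact: index_inj aV bV ltab.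
Qed.

Section rooted_graph.
Variable E : seq (nat * nat).
Hypothesis rE : rooted E.
Hypothesis noloop : loopless E.
Let V := vertex_list E.

Let gE_adj : rel nat := fun a b => (a != b) && (((a, b) \in E) || ((b, a) \in E)).

Let gE_sym : symmetric gE_adj.
Proof. by move=> a b; rewrite /gE_adj eq_sym orbC. Qed.

Let gE_irr : irreflexive gE_adj.
Proof. by move=> a; rewrite /gE_adj eqxx. Qed.

(** Apply rootedness to the smallest graph that contains E. *)
Lemma rooted_graph_connected : sgraph_connected (rooted_graph E).
Proof.
pose g := IGraph gE_sym gE_irr.
have gE : edge_list_event E g.
  by move=> p pE; rewrite /= /gE_adj (allP noloop)//= -surjective_pairing pE.
have i0 : (index 0%N V < size V)%N by rewrite index_mem vertex_list0.
pose r : 'I_(nverts (rooted_graph E)) := Ordinal i0.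
have reach (x : 'I_(nverts (rooted_graph E))) : connect (@adj (rooted_graph E)) r x.
  have xg : component g 0 (nth 0%N V x).
    have := mem_nth 0%N (ltn_ord x); rewrite -/V.
    case/mem_vertex_list => [->|[p pE [->|->]]]; first exact: component_refl.
      exact: rE gE _ pE.
    exact: component_trans (rE gE pE) (component_edge (gE _ pE)).
  move: xg => /component_closedP xg.
  have [x' [xx' cx']] : exists x' : 'I_(nverts (rooted_graph E)),
      nth 0%N V x' = nth 0%N V x /\ connect (@adj (rooted_graph E)) r x'.
    apply: (xg (fun a => exists x' : 'I_(nverts (rooted_graph E)),
      nth 0%N V x' = a /\ connect (@adj (rooted_graph E)) r x')).
      move=> a b /andP[ab Eab] [y [ya cy]].
      have bV : b \in V.
        by case/orP: Eab => /vertex_listP[].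
      have ib : (index b V < size V)%N by rewrite index_mem.
      exists (Ordinal ib); split; first by rewrite /= nth_index.
      apply: connect_trans cy (connect1 _).
      rewrite /= /edge_list_adj /= -/V nth_index// ya.
      suff -> : y != Ordinal ib by [].
      by apply/eqP => e; move: ab; rewrite -ya e /= nth_index ?eqxx.
    by exists r; split; [rewrite /= nth_index ?vertex_list0|].
  suff -> : x = x' by [].
  apply/esym/val_inj/eqP; rewrite -(nth_uniq 0%N (ltn_ord x') (ltn_ord x) (uniq_vertex_list E)).
  exact/eqP.
have csym : connect_sym (@adj (rooted_graph E)) by apply: sym_connect_sym; exact: adj_sym.
apply/forallP => x; apply/forallP => y.
by apply: connect_trans (reach y); rewrite csym.
Qed.

End rooted_graph.

(** * The law of a thinned sample *)

Lemma prob_eq_on d (T : measurableType d) (R : realType) (P : probability T R)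
    (A B C : set T) : measurable A -> measurable B -> measurable C -> P C = 1%E ->
  (forall x, C x -> (A x <-> B x)) -> P A = P B.
Proof.
move=> mA mB mC PC AB.
have PnC : P (~` C) = 0%E by rewrite probability_setC// PC subee.
have PE D : measurable D -> P D = P (D `&` C).
  move=> mD; rewrite [LHS](measureDI P mD mC) -[RHS]add0e; congr (_ + _)%E.
  apply/eqP; rewrite eq_le measure_ge0 andbT -PnC.
  apply: le_measure; rewrite ?inE; [exact: measurableD|exact: measurableC|].
  by move=> x [].
rewrite (PE A)// (PE B)//; congr (P _).
by apply/seteqP; split=> x [H Cx]; split => //; apply/(AB _ Cx).
Qed.

Lemma measurable_thin B : measurable_fun setT (thin B).
Proof.
apply: measurable_fun_igraph => a b.
rewrite (_ : [set g | _] = [set g : igraph |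
    kept B a && kept B b /\ [set g' : igraph | g' a b = true] g]).
  by apply: measurable_constI; exact: measurable_edge.
apply/seteqP; split=> g /=; first by move=> /and3P[-> -> ->].
by move=> [/andP[ka kb] gab]; apply/and3P.
Qed.

(** The random graph G thinned by independent marks of probability alpha, on
    the product of the probability spaces of the marks and of G. *)
Section thinned_law.
Context (R : realType) (alpha : R) (alpha01 : 0 <= alpha <= 1).
Context d (T : measurableType d) (P : probability T R)
  (G : {RV P >-> igraph}).

Definition marks (x : R) : pred nat := fun j => iter j (digit_shift alpha) x < alpha.

Definition thinned (z : measurableTypeR R * T) : igraph := thin (marks z.1) (G z.2).

Lemma measurable_kept a : measurable [set x : measurableTypeR R | kept (marks x) a].
Proof.
have [a0|a0] := eqVneq a 0%N.
  rewrite (_ : [set x | _] = setT)//; apply/seteqP; split=> x //= _.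
  by rewrite /kept a0.
rewrite (_ : [set x | _] = mark alpha a); first exact: measurable_mark.
by apply/seteqP; split=> x; rewrite /= /kept (negbTE a0).
Qed.

Lemma measurable_thinned : measurable_fun setT thinned.
Proof.
apply: measurable_fun_igraph => a b.
have mk c : measurable [set z : measurableTypeR R * T | kept (marks z.1) c].
  have mf : measurable_fun [set: measurableTypeR R * T] fst by exact: measurable_fst.
  by have := mf measurableT _ (measurable_kept c); rewrite setTI.
rewrite (_ : [set z | _] = [set z | G z.2 a b = true] `&`
    ([set z | kept (marks z.1) a] `&` [set z | kept (marks z.1) b])).
  apply: measurableI; last exact: measurableI.
  have mG := measurable_RV_preimage G (measurable_edge a b true).
  have mf : measurable_fun [set: measurableTypeR R * T] snd by exact: measurable_snd.
  by have := mf measurableT _ mG; rewrite setTI.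
apply/seteqP; split=> z /=; first by move=> /and3P[].
by move=> [gab [ka kb]]; apply/and3P.
Qed.

Definition thinned_law : {measure set igraph -> \bar R} :=
  image_measure (product_measure1 (@unit_measure R) P) (to_mfun measurable_thinned).

Definition thin_section (x : R) (A : set igraph) : set T :=
  [set w | A (thin (marks x) (G w))].

Lemma measurable_thin_section x A : measurable A -> measurable (thin_section x A).
Proof.
move=> mA.
have := measurableT_comp (measurable_thin (marks x)) (measurable_funPT G).
by move=> /(_ measurableT _ mA); rewrite setTI.
Qed.

Lemma thin_sectionE x A : thin_section x A = xsection (thinned @^-1` A) x.
Proof. by apply/seteqP; split=> w; rewrite /xsection /= inE. Qed.

Lemma thinned_lawE A : measurable A ->
  thinned_law A = (\int[@unit_measure R]_x P (thin_section x A))%E.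
Proof.
move=> mA; rewrite /thinned_law /= /pushforward /product_measure1.
by apply: eq_integral => x _ /=; rewrite thin_sectionE.
Qed.

Lemma thinned_law_const A (X : set (measurableTypeR R)) (q : \bar R) :
  measurable A -> measurable X -> unit_measure R (~` X) = 0%E ->
  (forall x, X x -> P (thin_section x A) = q) -> thinned_law A = q.
Proof.
move=> mA mX X0 Xq; rewrite thinned_lawE//.
rewrite -[RHS]mule1 -(unit_measure_setT R) -integral_cst//.
apply: ae_eq_integral => //.
  have mTA : measurable (thinned @^-1` A).
    by rewrite -[X in measurable X]setTI; exact: measurable_thinned.
  rewrite (_ : (fun x => _) = P \o xsection (thinned @^-1` A)).
    exact: measurable_fun_xsection.
  by apply/funext => x /=; rewrite thin_sectionE.
apply: (@negligibleS _ _ _ _ (~` X)).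
  by move=> x /= H Xx; apply: H => _; exact: Xq.
by apply/negligibleP => //; exact: measurableC.
Qed.

Lemma thinned_law_setT : thinned_law setT = 1%E.
Proof.
apply: (@thinned_law_const _ setT) => //; first by rewrite setCT measure0.
by move=> x _; rewrite (_ : thin_section x setT = setT) ?probability_setT.
Qed.

Variable Gam : graph_limit R.
Hypothesis GP : has_densities Gam G.

(** The vertices of E other than the first one must be marked, each with
    probability alpha; the first one is kept anyway. *)
Lemma thinned_law_edge_list E : loopless E ->
  thinned_law (edge_list_event E) =
  (alpha ^+ (size (vertex_list E)).-1 * Gam (rooted_graph E))%:E.
Proof.
move=> noloop; pose V := rem 0%N (vertex_list E).
have uV : uniq V by rewrite rem_uniq// uniq_vertex_list.
have [mV PV] := mark_prob alpha01 uV.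
have -> : thinned_law (edge_list_event E) =
    product_measure1 (@unit_measure R) P ([set x | forall j, j \in V -> mark alpha j x] `*`
      (G @^-1` edge_list_event E)).
  rewrite /thinned_law /= /pushforward; congr (product_measure1 _ _ _).
  apply/seteqP; split=> -[x w] /=.
    move=> /thin_edge_list[kE gE]; split=> //= j.
    rewrite (mem_rem_uniq _ (uniq_vertex_list E)) inE => /andP[j0 jV].
    have : kept (marks x) j.
      case: (mem_vertex_list jV) => [->|[p /kE[k1 k2] [->|->]]] //.
    by rewrite /kept (negbTE j0).
  move=> [mVx gE]; apply/thin_edge_list; split=> // p pE.
  have kV a : a \in vertex_list E -> kept (marks x) a.
    move=> aV; rewrite /kept; case: eqVneq => //= a0; apply: mVx.
    by rewrite (mem_rem_uniq _ (uniq_vertex_list E)) inE a0 aV.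
  by have [v1 v2] := vertex_listP pE; split; exact: kV.
rewrite product_measure1E//; last first.
  exact: measurable_RV_preimage (measurable_edge_list E).
rewrite [X in (X * _)%E](_ : _ = (alpha ^+ size V)%:E); last exact: PV.
rewrite [X in (_ * X)%E](_ : _ = (Gam (rooted_graph E))%:E).
  by rewrite size_rem ?vertex_list0.
exact: (edge_list_density GP _ (uniq_vertex_list E) noloop (@vertex_listP E)).
Qed.

Section connected_summand.
Hypothesis alpha_gt0 : 0 < alpha.
Hypothesis Gam_conn : connected_limit Gam.

Let X : set (measurableTypeR R) :=
  [set x | forall m, exists j, (m <= j)%N /\ mark alpha j x].

Let b x : set nat := [set a | kept (marks x) a].

Let infb x : X x -> infinite_set (b x).
Proof.
move=> Xx; apply/infinite_unbounded => m; have [j [mj xj]] := Xx m.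
by exists j; split => //; rewrite /b /= /kept [marks _ _]xj orbT.
Qed.

(** Given the marks, the graph on the marked vertices has the same law as the
    whole graph, hence it is almost surely connected. *)
Let conn_section x : X x ->
  P (G @^-1` (igraph_pull (nth_elt (b x)) @^-1` connected_graph)) = 1%E.
Proof.
move=> /infb infbx.
rewrite (law_igraph_pull GP (nth_elt_inj infbx) measurable_connected_graph).
exact: prob_connected_graph GP Gam_conn.
Qed.

Let measurable_conn_section x :
  measurable (G @^-1` (igraph_pull (nth_elt (b x)) @^-1` connected_graph)).
Proof.
apply: measurable_RV_preimage; rewrite -[X in measurable X]setTI.
by apply: measurable_igraph_pull => //; exact: measurable_connected_graph.
Qed.

(** To compute the probability of an event about the thinned graph, fix the
    marks, almost surely infinitely many, and describe the event assuming that
    the graph on the marked vertices is connected. *)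
Lemma thinned_law_when_connected (A : set igraph) (B : R -> set T) (q : \bar R) :
  measurable A -> (forall x, measurable (B x)) ->
  (forall x, X x -> P (B x) = q) ->
  (forall x w, X x -> connected_graph (igraph_pull (nth_elt (b x)) (G w)) ->
     (A (thin (marks x) (G w)) <-> B x w)) ->
  thinned_law A = q.
Proof.
move=> mA mB Bq AB; have [mX X0] := infinitely_many_marks alpha01 alpha_gt0.
apply: (thinned_law_const mA mX X0) => x Xx.
rewrite -(Bq x Xx); apply: (prob_eq_on _ _ (measurable_conn_section x)) => //.
- exact: measurable_thin_section.
- exact: conn_section.
- by move=> w; exact: AB.
Qed.

Lemma thinned_law_infinite : thinned_law infinite_component = 1%E.
Proof.
apply: (@thinned_law_when_connected _ (fun=> setT)) => //.
- exact: measurable_infinite_component.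
- by move=> x _; exact: probability_setT.
- move=> x w Xx conn; split=> // _.
  by rewrite /infinite_component /= thin_component//; exact: infb.
Qed.

Lemma thinned_law_singleton : thinned_law singleton_component = 0%E.
Proof.
apply: (@thinned_law_when_connected _ (fun=> set0)) => //.
- exact: measurable_singleton_component.
- move=> x w Xx conn; split=> // sC; case: singleton_not_infinite.
  by rewrite -[X in infinite_set X]sC thin_component//; exact: infb.
Qed.

Lemma thinned_law_relabelled A : measurable A ->
  thinned_law (relabelled_component @^-1` A) = P (G @^-1` A).
Proof.
move=> mA; have mpull x : measurable (igraph_pull (nth_elt (b x)) @^-1` A).
  by rewrite -[X in measurable X]setTI; exact: measurable_igraph_pull.
apply: (@thinned_law_when_connected _
  (fun x => G @^-1` (igraph_pull (nth_elt (b x)) @^-1` A))).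
- by rewrite -[X in measurable X]setTI; exact: measurable_relabelled_component.
- by move=> x; exact: measurable_RV_preimage.
- by move=> x /infb infbx; rewrite (law_igraph_pull GP (nth_elt_inj infbx)).
- by move=> x w Xx conn; rewrite /= thin_relabelled//; exact: infb.
Qed.

End connected_summand.

Section empty_summand.
Hypothesis P_no_edge : P (G @^-1` no_edge) = 1%E.

Lemma thinned_law_no_edge A : measurable A ->
  thinned_law A = P (G @^-1` A).
Proof.
move=> mA; apply: (@thinned_law_const _ setT) => //.
  by rewrite setCT measure0.
move=> x _; apply: (prob_eq_on _ _ _ P_no_edge).
- exact: measurable_thin_section.
- exact: measurable_RV_preimage.
- exact: measurable_RV_preimage measurable_no_edge.
- by move=> w nE; rewrite /thin_section /= thin_no_edge.
Qed.

Lemma thinned_law_no_edge_infinite : thinned_law infinite_component = 0%E.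
Proof.
rewrite thinned_law_no_edge; last exact: measurable_infinite_component.
rewrite -(measure0 P); apply: (prob_eq_on _ _ _ P_no_edge) => //.
- exact: measurable_RV_preimage measurable_infinite_component.
- exact: measurable_RV_preimage measurable_no_edge.
- move=> w nE; split=> //; rewrite /= /infinite_component /=.
  by rewrite (no_edge_component nE) => /singleton_not_infinite.
Qed.

Lemma thinned_law_no_edge_singleton : thinned_law singleton_component = 1%E.
Proof.
rewrite thinned_law_no_edge; last exact: measurable_singleton_component.
rewrite -(probability_setT P); apply: (prob_eq_on _ _ _ P_no_edge) => //.
- exact: measurable_RV_preimage measurable_singleton_component.
- exact: measurable_RV_preimage measurable_no_edge.
- by move=> w nE; split=> // _; exact: no_edge_component.
Qed.

Lemma thinned_law_no_edge_relabelled A : measurable A ->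
  thinned_law (relabelled_component @^-1` A) = P (G @^-1` A).
Proof.
have mr B : measurable B -> measurable (relabelled_component @^-1` B).
  by move=> mB; rewrite -[X in measurable X]setTI; exact: measurable_relabelled_component.
move=> mA; rewrite thinned_law_no_edge; last exact: mr.
apply: (prob_eq_on _ _ _ P_no_edge).
- exact: measurable_RV_preimage (mr _ mA).
- exact: measurable_RV_preimage.
- exact: measurable_RV_preimage measurable_no_edge.
- by move=> w nE; rewrite /= no_edge_relabelled.
Qed.

End empty_summand.

End thinned_law.

Lemma trivial_limit_no_edge (R : realType) d (T : measurableType d)
    (P : probability T R) (G : {RV P >-> igraph}) :
  has_densities (trivial_limit R) G -> P (G @^-1` no_edge) = 1%E.
Proof.
move=> GP; have mE := measurable_RV_preimage G measurable_no_edge.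
have mG i j := measurable_RV_preimage G (measurable_edge i j true).
suff H : P (~` (G @^-1` no_edge)) = 0%E.
  have := probability_setC P (measurableC mE).
  by rewrite setCK H sube0.
apply/negligibleP; first exact: measurableC.
pose A n : set T := if unpickle n is Some (i, j) then G @^-1` [set g : igraph | g i j = true]
  else set0.
apply: (@negligibleS _ _ _ _ (\bigcup_n A n)).
  move=> w /= /existsNP[i /existsNP[j gij]]; exists (pickle (i, j)) => //.
  by rewrite /A pickleK /=; case: (iadj _ i j) gij.
apply: negligible_bigcup => n; apply/negligibleP; rewrite /A; case: unpickle => //.
  by move=> [i j]; exact: mG.
move=> [i j]; have [<-|ij] := eqVneq i j.
  rewrite (_ : _ @^-1` _ = set0) ?measure0//; apply/seteqP; split=> w //=.
  by rewrite iadj_irr.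
pose E := [:: (i, j)].
have noloop : loopless E by rewrite /loopless /= ij.
rewrite (_ : _ @^-1` _ = G @^-1` edge_list_event E); last first.
  apply/seteqP; split=> w /= H; first by move=> p; rewrite inE => /eqP ->.
  by apply: (H (i, j)); rewrite inE.
etransitivity.
  exact: (edge_list_density GP (vertex_list_gt0 E) (uniq_vertex_list E) noloop
    (@vertex_listP E)).
rewrite /= (_ : (size_edges _ == 0)%N = false)//; apply/negbTE; rewrite -lt0n.
exact: (@rooted_graph_edges E).
Qed.

(** * The component of the first vertex in a direct sum *)

Section direct_sum_law.
Context (R : realType) (Gam : graph_limit R) (M : option nat)
  (alpha : nat -> R) (Gams : nat -> graph_limit R).
Hypothesis alpha_gt0 : forall i, (1 <= i)%N -> le_size i M -> 0 < alpha i.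
Hypothesis alpha_le1 : (\sum_(1 <= i <oo | le_size i M) (alpha i)%:E <= 1)%E.
Hypothesis decomposition : is_direct_sum M alpha Gams Gam.
Hypothesis alpha0 :
  (alpha 0%N)%:E = (1 - \sum_(1 <= i <oo | le_size i M) (alpha i)%:E)%E.
Hypothesis Gams0 : Gams 0%N = trivial_limit R.
Local Open Scope ereal_scope.

(** Setting the weights beyond M to 0 makes all sums range over the natural
    numbers. *)
Definition weight (i : nat) : R := if le_size i M then alpha i else 0%R.

Lemma le_size0 : le_size 0 M. Proof. by case: M. Qed.

Lemma sum_weights_ge1 :
  \sum_(1 <= i <oo) (weight i)%:E = \sum_(1 <= i <oo | le_size i M) (alpha i)%:E.
Proof.
rewrite [RHS]eseries_mkcond; apply: eq_eseriesr => i _.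
by rewrite /weight; case: ifP.
Qed.

Lemma weight_ge0 i : (0 <= weight i)%R.
Proof.
rewrite /weight; case: ifP => // iM; case: i iM => [_|i iM]; last first.
  by rewrite ltW// alpha_gt0.
by rewrite -lee_fin alpha0 sube_ge0// orbT.
Qed.

Lemma sum_weights : \sum_(0 <= i <oo) (weight i)%:E = 1.
Proof.
rewrite nneseries_recl// => [|i _]; last by rewrite lee_fin weight_ge0.
rewrite sum_weights_ge1 {1}/weight le_size0 alpha0 subeK//.
rewrite ge0_fin_numE; first by rewrite (le_lt_trans alpha_le1)// ltry.
rewrite -sum_weights_ge1; apply: nneseries_ge0 => i _ _.
by rewrite lee_fin weight_ge0.
Qed.

Lemma weight_le1 i : (weight i <= 1)%R.
Proof.
rewrite -lee_fin -sum_weights (@nneseriesD1 R (fun k => (weight k)%:E) i xpredT)//; last first.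
  by move=> k _; rewrite lee_fin weight_ge0.
rewrite leeDl//; apply: nneseries_ge0 => k _ _.
by rewrite lee_fin weight_ge0.
Qed.

Lemma weight01 i : (0 <= weight i <= 1)%R.
Proof. by rewrite weight_ge0 weight_le1. Qed.

Context d (T : measurableType d) (P : probability T R) (G : {RV P >-> igraph}).
Hypothesis GP : has_densities Gam G.
Context (ds : nat -> measure_display) (Ts : forall i, measurableType (ds i))
  (Ps : forall i, probability (Ts i) R) (Gs : forall i, {RV (Ps i) >-> igraph}).
Hypothesis GsP : forall i, le_size i M -> has_densities (Gams i) (Gs i).

(** The colour i of the first vertex is chosen with probability weight i; the
    other vertices have this colour with the same probability. *)
Definition mixture : {measure set igraph -> \bar R} :=
  mseries (fun i => mscale (NngNum (weight_ge0 i)) (thinned_law (weight i) (Gs i))) 0.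

Lemma mixtureE A :
  mixture A = \sum_(0 <= i <oo) (weight i)%:E * thinned_law (weight i) (Gs i) A.
Proof. by []. Qed.

(** The events of the generating pi-system have the right probabilities:
    for a connected graph F containing the first vertex the defining
    identity of the direct sum is that of the thinned mixture, the factor
    alpha^(v(F)) splitting into the weight of the summand and the
    probabilities of the v(F) - 1 other marks. *)
Lemma law_on_rooted_events A : <<s rooted_events >> A -> P (G @^-1` A) = mixture A.
Proof.
apply: (@probability_unique_on _ _ _ (distribution P G) mixture).
- exact: measurable_rooted_events.
- exact: rooted_events_setI.
- exact: rooted_events_setT.
- by rewrite /= /distribution /pushforward preimage_setT probability_setT ltry.
move=> _ [E rE ->].
rewrite -[LHS]/(P (G @^-1` _)).
have [->|En0] := eqVneq E [::].
  rewrite (_ : edge_list_event [::] = setT); last by apply/seteqP; split.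
  rewrite preimage_setT probability_setT mixtureE -sum_weights.
  by apply: eq_eseriesr => i _; rewrite thinned_law_setT mule1.
case: (boolP (loopless E)) => [noloop|/edge_list_loop ->]; last first.
  by rewrite preimage_set0 !measure0.
have -> : P (G @^-1` edge_list_event E) = (Gam (rooted_graph E))%:E.
  exact: (edge_list_density GP _ (uniq_vertex_list E) noloop (@vertex_listP E)).
rewrite decomposition; [|exact: rooted_graph_connected|exact: rooted_graph_edges].
rewrite mixtureE.
have term i : (weight i)%:E * thinned_law (weight i) (Gs i) (edge_list_event E) =
    if le_size i M
    then (alpha i ^+ nverts (rooted_graph E) * Gams i (rooted_graph E))%:E else 0.
  case: ifP => iM; last by rewrite /weight iM mul0e.
  rewrite (thinned_law_edge_list (weight01 i) (GsP iM) noloop) -EFinM.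
  rewrite /weight iM mulrA -exprS /=.
  by rewrite prednK// vertex_list_gt0.
rewrite nneseries_recl//; last first.
  by move=> i _; rewrite mule_ge0// lee_fin weight_ge0.
rewrite term le_size0 Gams0 /= (_ : (size_edges _ == 0)%N = false); last first.
  by apply/negbTE; rewrite -lt0n; exact: rooted_graph_edges.
rewrite mulr0 add0e eseries_mkcond; apply: eq_eseriesr => i _.
by rewrite term.
Qed.

(** Any event that depends on the component of the first vertex only is
    generated by the rooted edge lists. *)
Lemma law_of_component A : measurable A ->
  (forall g, A (component_graph g) <-> A g) -> P (G @^-1` A) = mixture A.
Proof.
move=> mA AE; apply: law_on_rooted_events.
rewrite (_ : A = component_graph @^-1` A); first exact: component_graph_rooted.
by apply/seteqP; split=> g /AE.
Qed.

Hypothesis Gams_connected :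
  forall i, (1 <= i)%N -> le_size i M -> connected_limit (Gams i).

Let G0_no_edge : Ps 0 (Gs 0%N @^-1` no_edge) = 1.
Proof. by apply: trivial_limit_no_edge; rewrite -Gams0; exact: GsP le_size0. Qed.

Lemma weight_gt0 i : (0 < i)%N -> le_size i M -> (0 < weight i)%R.
Proof. by move=> i0 iM; rewrite /weight iM alpha_gt0. Qed.

Lemma prob_infinite_component : P (G @^-1` infinite_component) =
  \sum_(1 <= i <oo | le_size i M) (alpha i)%:E.
Proof.
rewrite law_of_component; last 2 first.
- exact: measurable_infinite_component.
- by move=> g; rewrite /infinite_component /= component_component_graph.
rewrite mixtureE nneseries_recl//; last first.
  by move=> i _; rewrite mule_ge0// lee_fin weight_ge0.
rewrite thinned_law_no_edge_infinite// mule0 add0e.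
rewrite [RHS]eseries_mkcond [LHS]eseries_cond [RHS]eseries_cond.
apply: eq_eseriesr => i /andP[_ i1].
case: ifP => iM; last by rewrite /weight iM mul0e.
rewrite (thinned_law_infinite (weight01 i) (GsP iM)) ?mule1 ?weight_gt0//.
  by rewrite /weight iM.
exact: Gams_connected.
Qed.

Lemma prob_singleton_component : P (G @^-1` singleton_component) = (alpha 0%N)%:E.
Proof.
rewrite law_of_component; last 2 first.
- exact: measurable_singleton_component.
- by move=> g; rewrite /singleton_component /= component_component_graph.
rewrite mixtureE nneseries_recl//; last first.
  by move=> i _; rewrite mule_ge0// lee_fin weight_ge0.
rewrite thinned_law_no_edge_singleton// mule1 {1}/weight le_size0.
rewrite eseries_cond eseries0 ?adde0// => i _ /andP[_ i1].
have [iM|iM] := boolP (le_size i M); last by rewrite /weight (negbTE iM) mul0e.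
rewrite (thinned_law_singleton (weight01 i) (GsP iM)) ?mule0 ?weight_gt0//.
exact: Gams_connected.
Qed.

Lemma prob_relabelled A : measurable A ->
  P (G @^-1` (relabelled_component @^-1` A)) =
  \sum_(0 <= i <oo | le_size i M) (alpha i)%:E * Ps i (Gs i @^-1` A).
Proof.
move=> mA; rewrite law_of_component; last 2 first.
- by rewrite -[X in measurable X]setTI; exact: measurable_relabelled_component.
- by move=> g; rewrite /= relabelled_component_graph.
rewrite mixtureE [RHS]eseries_mkcond; apply: eq_eseriesr => i _.
case: ifP => iM; last by rewrite /weight iM mul0e.
have <- : weight i = alpha i by rewrite /weight iM.
congr (_ * _); case: i iM => [|i] iM.
  exact: thinned_law_no_edge_relabelled.
apply: (thinned_law_relabelled (weight01 _) (GsP iM)) => //.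
  exact: weight_gt0.
exact: Gams_connected.
Qed.

End direct_sum_law.

Lemma component_card1 g : component g 0 #= `I_1 <-> singleton_component g.
Proof.
split=> [/eq_cardSP[x gx]|]; last by move=> ->; exact: card_set1.
rewrite II0 card_eq0 => /eqP/seteqP[sub _].
have only u : component g 0 u -> u = x.
  by move=> gu; apply: contrapT => ux; have := sub u; apply.
apply/seteqP; split=> u; last by move=> ->; exact: component_refl.
by move=> /only ->; rewrite -(only 0%N)//; exact: component_refl.
Qed.


Theorem theorem1p24 (R : realType) (Gam : graph_limit R) (M : option nat)
  (alpha : nat -> R) (Gams : nat -> graph_limit R)
  (Gams_connected :
     forall i, (1 <= i)%N -> le_size i M -> connected_limit (Gams i))
  (alpha_gt0 : forall i, (1 <= i)%N -> le_size i M -> 0 < alpha i)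
  (alpha_le1 : (\sum_(1 <= i <oo | le_size i M) (alpha i)%:E <= 1)%E)
  (decomposition : is_direct_sum M alpha Gams Gam)
  (alpha0 :
     (alpha 0%N)%:E = (1 - \sum_(1 <= i <oo | le_size i M) (alpha i)%:E)%E)
  (Gams0 : Gams 0%N = trivial_limit R)
  (d : measure_display) (T : measurableType d) (P : probability T R)
  (G : {RV P >-> igraph}) (GP : is_Ginfty Gam G)
  (ds : nat -> measure_display) (Ts : forall i, measurableType (ds i))
  (Ps : forall i, probability (Ts i) R) (Gs : forall i, {RV (Ps i) >-> igraph})
  (GsP : forall i, le_size i M -> is_Ginfty (Gams i) (Gs i)) :
  let G1 := fun w => component (G w) 0%N in
  let H := fun w => relabelled_component (G w) in
  [/\ measurable [set w | infinite_set (G1 w)],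
      measurable [set w | G1 w #= `I_1],
      {ae P, forall w, G1 w #= `I_1 \/ infinite_set (G1 w)},
      P [set w | infinite_set (G1 w)] =
        (\sum_(1 <= i <oo | le_size i M) (alpha i)%:E)%E &
      P [set w | G1 w #= `I_1] = (alpha 0%N)%:E] /\
  exchangeable P H /\
  (forall A : set igraph, measurable A ->
     P (H @^-1` A) =
       (\sum_(0 <= i <oo | le_size i M)
          ((alpha i)%:E * Ps i (Gs i @^-1` A)))%E).
Proof.
move=> G1 H.
have GD := Ginfty_has_densities GP.
have GsD i iM := Ginfty_has_densities (GsP i iM).
have PI : P (G @^-1` infinite_component) = _ :=
  prob_infinite_component alpha_gt0 alpha_le1 decomposition alpha0 Gams0 GD GsD
    Gams_connected.
have PS : P (G @^-1` singleton_component) = _ :=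
  prob_singleton_component alpha_gt0 alpha_le1 decomposition alpha0 Gams0 GD GsD
    Gams_connected.
have PH A : measurable A -> P (H @^-1` A) = _ :=
  prob_relabelled alpha_gt0 alpha_le1 decomposition alpha0 Gams0 GD GsD
    Gams_connected (A := A).
have mI := measurable_RV_preimage G measurable_infinite_component.
have mS := measurable_RV_preimage G measurable_singleton_component.
have SE : [set w | G1 w #= `I_1] = G @^-1` singleton_component.
  by apply/seteqP; split=> w /component_card1.
have fin_sum : (\sum_(1 <= i <oo | le_size i M) (alpha i)%:E)%E \is a fin_num.
  by rewrite -PI fin_num_measure.
split; [split|split; last exact: PH].
- exact: mI.
- by rewrite SE.
- have mSI := measurableU _ _ mS mI.
  have P1 : P (G @^-1` singleton_component `|` G @^-1` infinite_component) = 1%E.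
    have -> : P (G @^-1` singleton_component `|` G @^-1` infinite_component) =
        (P (G @^-1` singleton_component) + P (G @^-1` infinite_component))%E.
      apply: measureU => //; apply/seteqP; split=> w //= [sw iw].
      by apply: singleton_not_infinite; rewrite -sw.
    by rewrite PI PS alpha0 subeK.
  apply: (@negligibleS _ _ _ _
    (~` (G @^-1` singleton_component `|` G @^-1` infinite_component))).
    move=> w /= nw [sw|iw]; apply: nw; [left|right] => //.
    exact/component_card1.
  apply/negligibleP; first exact: measurableC.
  by rewrite [LHS]probability_setC// P1 subee.
- exact: PI.
- by rewrite SE.
- split.
    exact: measurableT_comp measurable_relabelled_component (measurable_funPT G).
  move=> s s_bij A mA.
  have mA' : measurable (igraph_pull s @^-1` A).
    by rewrite -[X in measurable X]setTI; exact: measurable_igraph_pull.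
  rewrite [LHS](PH _ mA') [RHS](PH _ mA).
  apply: eq_eseriesr => i iM; congr (_ * _)%E.
  exact: (law_igraph_pull (GsD i iM) (bij_inj s_bij)).
Qed.
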